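(* Let $\Delta>3$. Then the spectrum $\sigma(H_{\mathbb{Z}})$ of the infinite XXZ chain Hamiltonian with anisotropy parameter $\Delta$ has a gap of width $1-\frac{3}{\Delta}$ above the first band, i.e. $$\sigma(H_{\mathbb{Z}}) \cap \left(-\infty,\, 2-\frac{2}{\Delta}\right) = \{0\} \cup \left[1-\frac{1}{\Delta},\, 1+\frac{1}{\Delta}\right].$$
   Context: Let $M$ be the countable set of all finite subsets of $\mathbb{Z}$ (including $\emptyset$), $\ell^2(M)$ the complex Hilbert space of square-summable functions on $M$, with canonical orthonormal basis $(\phi_J)_{J\in M}$. Think of $\phi_J$ as the spin configuration on $\mathbb{Z}$ with down-spins exactly at the sites in $J$. Let $\ell^2_0(M)$ be the space of finite linear combinations of the $\phi_J$. For $x\in\mathbb{Z}$ define linear operators on $\ell^2_0(M)$ by $t_{x,x+1}\phi_J=\phi_{\tau_x(J)}$, where $\tau_x$ is the transposition of $\mathbb{Z}$ exchanging $x$ and $x+1$, and $\pi_{x,x+1}\phi_J=\phi_J$ if $\#(J\cap\{x,x+1\})\in\{0,2\}$, $\pi_{x,x+1}\phi_J=-\phi_J$ if $\#(J\cap\{x,x+1\})=1$. For $\Delta>1$ put $$h_{x,x+1}=-\frac{1}{2\Delta}(t_{x,x+1}-I)-\frac14\left(1-\frac1\Delta\right)(\pi_{x,x+1}-I).$$ For each $J$, $h_{x,x+1}\phi_J=0$ for all but finitely many $x$, so $H_{\mathbb{Z},0}f=\sum_{x\in\mathbb{Z}}h_{x,x+1}f$ is a well-defined operator on $\ell^2_0(M)$.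 It is essentially self-adjoint in $\ell^2(M)$, and the infinite XXZ chain Hamiltonian is its self-adjoint closure $H_{\mathbb{Z}}:=\overline{H_{\mathbb{Z},0}}$ (a non-negative operator). *)

(* Defs.v *)
From HB Require Import structures.
From mathcomp Require Import all_boot all_order all_algebra finmap.
From mathcomp Require Import complex.
From mathcomp Require Import all_classical all_reals all_analysis.
From mathcomp Require Import ring lra.

Set Implicit Arguments.
Unset Strict Implicit.
Unset Printing Implicit Defensive.

Import Order.TTheory GRing.Theory Num.Theory.
Import numFieldNormedType.Exports.

Local Open Scope classical_set_scope.
Local Open Scope complex_scope.
Local Open Scope ring_scope.

Section ell2.
Context (R : realType) (I : choiceType).
Implicit Types f g : I -> R[i].

Definition sqnorm f : \bar R :=
  \esum_(i in [set: I]) (Normc.normc (f i) ^+ 2)%:E.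

Definition square_summable : {pred I -> R[i]} := [pred f | (sqnorm f < +oo)%E].

Record ell2 := Ell2 {
  ell2_fun :> I -> R[i];
  ell2P : ell2_fun \in square_summable }.

HB.instance Definition _ := [isSub for ell2_fun].
HB.instance Definition _ := [Choice of ell2 by <:].

Lemma normc_ge0 (z : R[i]) : 0 <= Normc.normc z.
Proof. by case: z => a b; exact: sqrtr_ge0. Qed.

Lemma sqnorm_ge0 f : (0 <= sqnorm f)%E.
Proof. by apply: esum_ge0 => i _; rewrite lee_fin sqr_ge0. Qed.

Lemma esumZ (r : R) (u : I -> \bar R) : 0 <= r -> (forall i, 0 <= u i)%E ->
  (\esum_(i in [set: I]) (r%:E * u i) = r%:E * \esum_(i in [set: I]) u i)%E.
Proof.
move=> r0 u0; rewrite /esum -ereal_supZl//; last first.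
  by apply/set0P; exists (\sum_(i \in set0) u i)%E; exists set0.
rewrite image_comp; congr ereal_sup; apply: eq_imagel => A _ /=.
by rewrite ge0_mule_fsumr.
Qed.

Lemma sqnorm0 : sqnorm 0 = 0%E.
Proof. by apply: esum1 => i _; rewrite Normc.normc0 expr0n. Qed.

Lemma sqnormZ (a : R[i]) f :
  sqnorm (a *: f) = ((Normc.normc a ^+ 2)%:E * sqnorm f)%E.
Proof.
rewrite -esumZ ?sqr_ge0//; last by move=> i; rewrite lee_fin sqr_ge0.
by apply: eq_esum => i _; rewrite Normc.normcM exprMn.
Qed.

Lemma sqnormD_le (t : R) f g : 0 < t ->
  (sqnorm (f + g)%R <=
    (1 + t)%:E * sqnorm f + (1 + t^-1)%:E * sqnorm g)%E.
Proof.
move=> t0; have ti0 : 0 < t^-1 by rewrite invr_gt0.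
have r0 (s : R) : 0 < s -> 0 <= 1 + s by move=> s0; rewrite addr_ge0// ltW.
have sq0 (h : I -> R[i]) i : (0 <= (Normc.normc (h i) ^+ 2)%:E)%E by rewrite lee_fin sqr_ge0.
rewrite -(esumZ (r0 _ t0) (sq0 f)) -(esumZ (r0 _ ti0) (sq0 g)) -esumD; last 2 first.
  by move=> i _; apply: mule_ge0 => //; rewrite lee_fin r0.
  by move=> i _; apply: mule_ge0 => //; rewrite lee_fin r0.
rewrite /sqnorm; apply: le_esum => i _; rewrite -!EFinM -EFinD lee_fin.
have := le_normcD (f i) (g i).
move: (normc_ge0 (f i)) (normc_ge0 (g i)) (normc_ge0 ((f + g) i)).
rewrite -[(f + g) i]/(f i + g i).
set x := Normc.normc (f i); set y := Normc.normc (g i).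
set z := Normc.normc _ => x0 y0 z0 zxy.
apply: (@le_trans _ _ ((x + y) ^+ 2)); first by rewrite ler_sqr ?nnegrE ?addr_ge0.
rewrite -subr_ge0.
rewrite (_ : _ - _ = t^-1 * (t * x - y) ^+ 2).
  by rewrite mulr_ge0 ?sqr_ge0// ltW.
by field; rewrite gt_eqF.
Qed.

Lemma square_summable_submod_closed : submod_closed square_summable.
Proof.
split=> [|a f g]; rewrite !inE ?sqnorm0// => fy gy.
apply: (le_lt_trans (sqnormD_le _ _ ltr01)).
have mul_fin (c : R) x : 0 <= c -> (x < +oo)%E -> (c%:E * x < +oo)%E.
  by move=> c0 xy; rewrite lte_mul_pinfty.
rewrite sqnormZ lte_add_pinfty// !mul_fin ?addr_ge0 ?invr_ge0 ?sqr_ge0//.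
Qed.

HB.instance Definition _ :=
  GRing.isSubmodClosed.Build _ _ square_summable square_summable_submod_closed.
HB.instance Definition _ := [SubChoice_isSubLmodule of ell2 by <:].

Definition ell2_norm (f : ell2) : R := Num.sqrt (fine (sqnorm f)).

Lemma ell2_norm_sqr (f : ell2) : (ell2_norm f ^+ 2)%:E = sqnorm f.
Proof.
have := ell2P f; rewrite inE => fy.
rewrite sqr_sqrtr ?fine_ge0 ?sqnorm_ge0// fineK//.
by rewrite ge0_fin_numE ?sqnorm_ge0.
Qed.

Lemma ell2_norm0_eq0 (f : ell2) : ell2_norm f = 0 -> f = 0.
Proof.
move=> f0; apply/val_inj/funext => i /=; apply: Normc.eq0_normc.
apply/eqP; rewrite -sqrf_eq0 eq_le sqr_ge0 andbT -lee_fin.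
apply: (@le_trans _ _ (sqnorm f)); last by rewrite -ell2_norm_sqr f0 expr0n.
apply: esum_ge; exists [set i]; first by split=> //; exact: finite_set1.
by rewrite fsbig_set1.
Qed.

Lemma ell2_normD (f g : ell2) : ell2_norm (f + g) <= ell2_norm f + ell2_norm g.
Proof.
have [f0|f0] := eqVneq (ell2_norm f) 0.
  by rewrite (ell2_norm0_eq0 f0) add0r lerDr sqrtr_ge0.
have [g0|g0] := eqVneq (ell2_norm g) 0.
  by rewrite (ell2_norm0_eq0 g0) addr0 lerDl sqrtr_ge0.
have A0 : 0 < ell2_norm f by rewrite lt0r f0 sqrtr_ge0.
have B0 : 0 < ell2_norm g by rewrite lt0r g0 sqrtr_ge0.
rewrite -ler_sqr ?nnegrE ?addr_ge0 ?sqrtr_ge0// -lee_fin ell2_norm_sqr.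
apply: (le_trans (sqnormD_le _ _ (divr_gt0 B0 A0))).
rewrite -!ell2_norm_sqr -!EFinM -EFinD lee_fin le_eqVlt; apply/orP; left.
by apply/eqP; field; rewrite f0 g0.
Qed.

Lemma ell2_normZ (a : R[i]) (f : ell2) :
  ell2_norm (a *: f) = Normc.normc a * ell2_norm f.
Proof.
apply/eqP; rewrite -(@eqrXn2 _ 2) ?mulr_ge0 ?sqrtr_ge0 ?normc_ge0//.
by rewrite -eqe exprMn ell2_norm_sqr sqnormZ -ell2_norm_sqr -EFinM.
Qed.

(* A normed module over R[i] has an R[i]-valued norm, hence the embedding. *)
Definition ell2_normC (f : ell2) : R[i] := (ell2_norm f)%:C.

Lemma ell2_normCD (f g : ell2) : ell2_normC (f + g) <= ell2_normC f + ell2_normC g.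
Proof. by rewrite /ell2_normC -rmorphD/= lecR ell2_normD. Qed.

Lemma ell2_normCZ (a : R[i]) (f : ell2) :
  ell2_normC (a *: f) = `|a| * ell2_normC f.
Proof. by rewrite /ell2_normC ell2_normZ rmorphM. Qed.

Lemma ell2_normC0_eq0 (f : ell2) : ell2_normC f = 0 -> f = 0.
Proof. by move=> [] /ell2_norm0_eq0. Qed.

HB.instance Definition _ := @Lmodule_isNormed.Build R[i] ell2 ell2_normC
  ell2_normCD ell2_normCZ ell2_normC0_eq0.

Definition ell2_basis_fun (i : I) : I -> R[i] := fun j => (j == i)%:R.

Lemma ell2_basis_subproof (i : I) : ell2_basis_fun i \in square_summable.
Proof.
have sq0 j : (0 <= (Normc.normc (ell2_basis_fun i j) ^+ 2)%:E)%E.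
  by rewrite lee_fin sqr_ge0.
rewrite inE /sqnorm (esumID [set i]); last by move=> j _; exact: sq0.
rewrite !setTI esum_set1 ?sq0//.
rewrite [X in (_ + X)%E]esum1 ?adde0 ?ltry// => j /= /eqP ji.
by rewrite /ell2_basis_fun (negbTE ji) Normc.normc0 expr0n.
Qed.

Definition ell2_basis (i : I) : ell2 := Ell2 (ell2_basis_subproof i).

End ell2.

Section resolvent.
Context (K : numFieldType) (V : normedModType K).

(* A partially defined operator is represented by its graph A. The map S below
   is the bounded, everywhere defined inverse of A - z. *)
Definition resolvent_set (A : set (V * V)) : set K :=
  [set z | exists S : {linear V -> V}, continuous S /\
    forall f g, A (f, g + z *: f) <-> f = S g].

Definition spectrum (A : set (V * V)) : set K := ~` resolvent_set A.

End resolvent.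

Section finite_combinations.
Context (R : realType) (I : choiceType).
Local Notation phi := (@ell2_basis R I).
Implicit Types f g : ell2 R I.

(* The span of the basis vectors; see ell2_0_expand. *)
Definition ell2_0 : set (ell2 R I) := [set f | finite_set [set i | f i != 0]].

(* The operator on ell2_0 that maps the basis vector at i to a i. The sum
   over \in is the finitely supported one: it is meaningful on ell2_0 only. *)
Definition linear_extension (a : I -> ell2 R I) f : ell2 R I :=
  \sum_(i \in [set: I]) f i *: a i.

Lemma ell2_eqP f g : (forall i, f i = g i) -> f = g.
Proof. by move=> fg; apply/val_inj/funext. Qed.

Lemma ell2_sumE (T : Type) (s : seq T) (F : T -> ell2 R I) i :
  (\sum_(j <- s) F j) i = \sum_(j <- s) F j i.
Proof.
elim: s => [|j s IH]; first by rewrite !big_nil.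
by rewrite !big_cons -IH.
Qed.

Lemma ell2_scaleE (a : R[i]) f i : (a *: f) i = a * f i.
Proof. by []. Qed.

Lemma ell2_basisE i j : phi i j = (j == i)%:R.
Proof. by []. Qed.

Lemma linear_extensionE (a : I -> ell2 R I) f (S : {fset I}) :
  (forall i, i \notin S -> f i = 0) ->
  linear_extension a f = \sum_(i <- S) f i *: a i.
Proof. by move=> fS; apply: fsbigTE => i /fS ->; rewrite scale0r. Qed.

Lemma linear_extension_basis (a : I -> ell2 R I) i :
  linear_extension a (phi i) = a i.
Proof.
rewrite (@linear_extensionE _ _ [fset i]%fset) ?big_seq_fset1.
  by rewrite ell2_basisE eqxx scale1r.
by move=> j; rewrite inE ell2_basisE => /negbTE ->.
Qed.

Lemma ell2_0_fset f : ell2_0 f ->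
  exists S : {fset I}, forall i, i \notin S -> f i = 0.
Proof.
move=> ff; exists (fset_set [set i | f i != 0]) => i.
by rewrite in_fset_set// notin_setE/= => /negP; rewrite negbK => /eqP.
Qed.

Lemma ell2_0_expand f : ell2_0 f -> linear_extension phi f = f.
Proof.
move=> /ell2_0_fset[S fS]; rewrite (linear_extensionE _ fS).
apply: ell2_eqP => i; rewrite ell2_sumE.
have [iS|iS] := boolP (i \in S).
  rewrite (big_fsetD1 i iS) big_seq big1.
    by rewrite Monoid.mulm1 ell2_scaleE ell2_basisE eqxx mulr1.
  move=> j; rewrite !inE => /andP[ji _].
  by rewrite ell2_scaleE ell2_basisE eq_sym (negbTE ji) mulr0.
rewrite big_seq big1 ?fS// => j jS.
rewrite ell2_scaleE ell2_basisE.
by case: eqP => [ij|]; rewrite ?mulr0//; rewrite ij jS in iS.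
Qed.

Lemma ell2_eval_le f i : `|f i| <= `|f|.
Proof.
change ((Normc.normc (f i))%:C <= (ell2_norm f)%:C); rewrite lecR.
rewrite -ler_sqr ?nnegrE ?sqrtr_ge0 ?normc_ge0// -lee_fin ell2_norm_sqr.
apply: esum_ge; exists [set i]; first by split=> //; exact: finite_set1.
by rewrite fsbig_set1.
Qed.

Lemma ell2_eval_continuous i : continuous (fun f => f i : R[i]^o).
Proof.
move=> f; apply/(@cvgrPdist_lt _ R[i]^o _ (nbhs f) _ (fun g => g i : R[i]^o) (f i)) => e e0.
near=> g; apply: le_lt_trans (ell2_eval_le (f - g) i) _.
near: g. exact: (@cvgr_dist_lt _ (ell2 R I) _ (nbhs f) _ id f (@cvg_id _ (nbhs f))).
Unshelve. all: by end_near. Qed.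

End finite_combinations.

(* The set of sites carrying a down-spin. *)
Definition configuration := {fset int}.

Section xxz.
Context (R : realType) (Delta : R).
Local Notation M := configuration.
Local Notation phi := (@ell2_basis R M).
Implicit Types (x : int) (J : M) (f : ell2 R M).

(* The transposition exchanging x and x + 1. *)
Definition tau x : int -> int := [eta id with x |-> x + 1, x + 1 |-> x].

Definition t_op x : ell2 R M -> ell2 R M :=
  linear_extension (fun J => phi [fset tau x y | y in J]%fset).

Definition pi_op x : ell2 R M -> ell2 R M :=
  linear_extension (fun J =>
    if #|` (J `&` [fset x; (x + 1)%R])%fset | == 1%N then - phi J else phi J).

Definition h_op x f : ell2 R M :=
  - (1 / (2 * Delta))%:C *: (t_op x f - f)
  - (1 / 4 * (1 - 1 / Delta))%:C *: (pi_op x f - f).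

(* The graph of the operator with domain ell2_0; by h_op_finite the sum over x
   has finitely many nonzero terms. *)
Definition H_Z0 : set (ell2 R M * ell2 R M) :=
  [set p | ell2_0 p.1 /\ p.2 = \sum_(x \in [set: int]) h_op x p.1].

(* The graph of the closure of an operator is the closure of its graph, for the
   product topology; by H_Z_functional it is again the graph of an operator. *)
Definition H_Z : set (ell2 R M * ell2 R M) := closure H_Z0.

End xxz.

Section xxz_theory.
Context (R : realType) (Delta : R).
Local Notation M := configuration.
Local Notation phi := (@ell2_basis R M).
Implicit Types (x : int) (J : M) (f : ell2 R M).

Lemma tauK x : involutive (tau x).
Proof.
move=> y; rewrite /tau /=.
have x1 : (x + 1 == x) = false by apply/negbTE; rewrite -subr_eq0 addrAC subrr.
have [->|yx] := eqVneq y x; first by rewrite x1 eqxx.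
have [->|yx1] := eqVneq y (x + 1); first by rewrite eqxx.
by rewrite (negbTE yx) (negbTE yx1).
Qed.


Lemma t_op_basis x J : t_op x (phi J) = phi [fset tau x y | y in J]%fset.
Proof. exact: linear_extension_basis. Qed.

Lemma pi_op_basis x J : pi_op x (phi J) =
  if #|` (J `&` [fset x; (x + 1)%R])%fset | == 1%N then - phi J else phi J.
Proof. exact: linear_extension_basis. Qed.

Lemma tau_imfsetK x J :
  [fset tau x y | y in [fset tau x y | y in J]%fset]%fset = J.
Proof.
apply/fsetP => y; apply/imfsetP/idP => [[_ /imfsetP[z /= zJ ->] ->]|yJ].
  by rewrite tauK.
by exists (tau x y); rewrite ?tauK//; apply/imfsetP; exists y.
Qed.

Lemma tau_imfset_id x J : x \notin J -> x + 1 \notin J ->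
  [fset tau x y | y in J]%fset = J.
Proof.
move=> xJ x1J; have tJ y : y \in J -> tau x y = y.
  move=> yJ; rewrite /tau /=; case: eqP => [yx|_]; first by rewrite -yx yJ in xJ.
  by case: eqP => [yx|//]; rewrite -yx yJ in x1J.
apply/fsetP => y; apply/imfsetP/idP => [[z /= zJ ->]|yJ]; first by rewrite tJ.
by exists y; rewrite ?tJ.
Qed.

Lemma t_opE x f J : ell2_0 f -> t_op x f J = f [fset tau x y | y in J]%fset.
Proof.
move=> /ell2_0_fset[S fS]; rewrite /t_op (linear_extensionE _ fS) ell2_sumE.
set K : M := [fset _ | _ in J]%fset.
have KE (L : M) : (J == [fset tau x y | y in L]%fset) = (L == K).
  apply/eqP/eqP => [JL|->]; first by rewrite /K JL tau_imfsetK.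
  by rewrite tau_imfsetK.
have [KS|KS] := boolP (K \in S).
  rewrite (big_fsetD1 K KS) big_seq big1.
    by rewrite Monoid.mulm1 ell2_scaleE ell2_basisE KE eqxx mulr1.
  move=> L; rewrite !inE => /andP[LK _].
  by rewrite ell2_scaleE ell2_basisE KE (negbTE LK) mulr0.
rewrite big_seq big1 ?fS// => L LS.
rewrite ell2_scaleE ell2_basisE KE.
by case: eqP => [LK|]; rewrite ?mulr0//; rewrite LK (negbTE KS) in LS.
Qed.

Lemma pi_opE x f J : ell2_0 f -> pi_op x f J =
  if #|` (J `&` [fset x; (x + 1)%R])%fset | == 1%N then - f J else f J.
Proof.
move=> f0; rewrite -{2 3}(ell2_0_expand f0).
have /ell2_0_fset[S fS] := f0.
rewrite /pi_op !(linear_extensionE _ fS) !ell2_sumE -sumrN.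
have ifE (b : bool) (L : M) :
    (if b then - phi L else phi L) J = if b then - phi L J else phi L J.
  by case: b.
have E (L : M) :
    (if #|` (L `&` [fset x; (x + 1)%R])%fset | == 1%N then - phi L else phi L) J =
    if #|` (J `&` [fset x; (x + 1)%R])%fset | == 1%N then - phi L J else phi L J.
  rewrite ifE; have [->//|JL] := eqVneq J L.
  by rewrite ell2_basisE (negbTE JL) oppr0 !if_same.
by case: ifPn E => _ E; apply: eq_bigr => L _; rewrite !ell2_scaleE E ?mulrN.
Qed.

Lemma h_op_eq0 x f : ell2_0 f ->
  (forall J, f J != 0 -> x \notin J /\ x + 1 \notin J) -> h_op Delta x f = 0.
Proof.
move=> f0 fx; rewrite /h_op.
suff [-> ->] : t_op x f = f /\ pi_op x f = f by rewrite subrr !scaler0 subrr.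
have fx' J : x \in J \/ x + 1 \in J -> f J = 0.
  move=> xJ; apply/eqP/negP => /negP/fx[/negP x0 /negP x1]; by case: xJ.
have tx J : x \in [fset tau x y | y in J]%fset = (x + 1 \in J).
  by rewrite -{1}[x](tauK x) mem_imfset; [rewrite /tau/= eqxx|exact: inv_inj (tauK x)].
have tx1 J : x + 1 \in [fset tau x y | y in J]%fset = (x \in J).
  rewrite -{1}[x + 1](tauK x) mem_imfset; last exact: inv_inj (tauK x).
  by rewrite /tau/= eqxx; case: ifP => // /eqP ->.
split; apply: ell2_eqP => J.
  rewrite t_opE//.
  have [xJ|xJ] := boolP (x \in J); first by rewrite !fx' ?tx1 ?xJ; auto.
  have [x1J|x1J] := boolP (x + 1 \in J); first by rewrite !fx' ?tx ?x1J; auto.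
  by rewrite tau_imfset_id.
rewrite pi_opE//.
have [->|/fx[xJ x1J]] := eqVneq (f J) 0; first by rewrite oppr0 if_same.
rewrite (_ : (_ `&` _)%fset = fset0) ?cardfs0//.
apply/fsetP => y; rewrite !inE; apply/negP => /andP[yJ /orP[/eqP yx|/eqP yx]].
  by rewrite -yx yJ in xJ.
by rewrite -yx yJ in x1J.
Qed.

Lemma h_op_finite f : ell2_0 f -> finite_set [set x | h_op Delta x f != 0].
Proof.
move=> f0; have /ell2_0_fset[S fS] := f0.
pose X : {fset int} := (\bigcup_(J <- S) (J `|` [fset (y - 1)%R | y in J]))%fset.
apply: (@sub_finite_set _ _ [set` X]); last exact: finite_fset.
move=> x /=; apply: contra_neqT => xX; apply: h_op_eq0 => // J fJ.
have JS : J \in S by apply: contraNT fJ => /fS ->.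
split; apply: contra xX => xJ; apply/bigfcupP; exists J; rewrite ?JS// inE ?xJ//.
by apply/orP; right; apply/imfsetP; exists (x + 1) => //=; rewrite addrK.
Qed.


Lemma h_opE x f J : ell2_0 f -> h_op Delta x f J =
  - (1 / (2 * Delta))%:C * (f [fset tau x y | y in J]%fset - f J)
  - (1 / 4 * (1 - 1 / Delta))%:C *
    ((if #|` (J `&` [fset x; (x + 1)%R])%fset | == 1%N then - f J else f J) - f J).
Proof. by move=> f0; rewrite -t_opE// -pi_opE. Qed.

Lemma H_Z0_eval J : exists L : ell2 R M -> R[i]^o, continuous L /\
  forall f g, H_Z0 Delta (f, g) -> g J = L f.
Proof.
pose X : {fset int} := (J `|` [fset (y - 1)%R | y in J])%fset.
pose c x f : R[i]^o :=
  - (1 / (2 * Delta))%:C * (f [fset tau x y | y in J]%fset - f J)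
  - (1 / 4 * (1 - 1 / Delta))%:C *
    ((if #|` (J `&` [fset x; (x + 1)%R])%fset | == 1%N then - f J else f J) - f J).
have c0 x f : x \notin X -> c x f = 0.
  rewrite inE negb_or => /andP[xJ x1J].
  have {}x1J : x + 1 \notin J.
    by apply: contra x1J => x1J; apply/imfsetP; exists (x + 1) => //=; rewrite addrK.
  rewrite /c tau_imfset_id// (_ : (_ `&` _)%fset = fset0) ?cardfs0/= ?subrr ?mulr0 ?subr0//.
  apply/fsetP => y; rewrite !inE; apply/negP => /andP[yJ /orP[/eqP yx|/eqP yx]].
    by rewrite -yx yJ in xJ.
  by rewrite -yx yJ in x1J.
exists (fun f => \sum_(x <- X) c x f); split.
  have evc K := @ell2_eval_continuous R M K.
  have cc x : continuous (c x).
    have cZ (k : R[i]) (u : ell2 R M -> R[i]^o) :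
        continuous u -> continuous (fun f => k * u f : R[i]^o).
      by move=> cu f; exact: (@cvgZl_tmp R[i] R[i]^o _ _ _ k u _ (cu f)).
    have cB (u v : ell2 R M -> R[i]^o) :
        continuous u -> continuous v -> continuous (fun f => u f - v f : R[i]^o).
      by move=> cu cv f; exact: (@cvgB _ R[i]^o _ _ _ _ _ _ _ (cu f) (cv f)).
    have cI (b : bool) : continuous (fun f => (if b then - f J else f J) : R[i]^o).
      case: b; last exact: evc.
      by move=> f; exact: (@cvgN _ R[i]^o _ _ _ _ _ (evc J f)).
    exact: (cB _ _ (cZ _ _ (cB _ _ (evc _) (evc _)))
                   (cZ _ _ (cB _ _ (cI _) (evc _)))).
  elim: (enum_fset X) => [|x s IH].
    rewrite (_ : (fun f => _) = cst 0); first exact: cst_continuous.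
    by apply/funext => f; rewrite big_nil.
  rewrite (_ : (fun f => _) = c x \+ (fun f => \sum_(y <- s) c y f)).
    by move=> f; exact: (@cvgD _ R[i]^o _ _ _ _ _ _ _ (cc x f) (IH f)).
  by apply/funext => f; rewrite big_cons.
move=> f g [/= f0 gE]; have fin := h_op_finite f0.
have {gE}-> : g = \sum_(x \in [set: int]) h_op Delta x f := gE.
pose Y := (X `|` fset_set [set x | h_op Delta x f != 0%R])%fset.
rewrite (fsbigTE Y); last first.
  move=> x; rewrite !inE negb_or => /andP[_]; rewrite in_fset_set// notin_setE/=.
  by move=> /negP; rewrite negbK => /eqP.
rewrite ell2_sumE [LHS](eq_bigr (c ^~ f)); last by move=> x _; rewrite h_opE.
rewrite -(@fsbigTE _ _ _ _ Y (c ^~ f)) => [|x]; last first.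
  by rewrite inE negb_or => /andP[xX _]; exact: c0.
by rewrite (fsbigTE X)// => x /c0.
Qed.

Lemma H_Z_functional f g g' : H_Z Delta (f, g) -> H_Z Delta (f, g') -> g = g'.
Proof.
suff H u v J : H_Z Delta (u, v) -> forall L : ell2 R M -> R[i]^o, continuous L ->
    (forall f g, H_Z0 Delta (f, g) -> g J = L f) -> v J = L u.
  move=> Hg Hg'; apply: ell2_eqP => J; have [L [cL HL]] := H_Z0_eval J.
  by rewrite (H _ _ _ Hg L cL HL) (H _ _ _ Hg' L cL HL).
move=> Huv L cL HL.
pose F (p : ell2 R M * ell2 R M) : R[i]^o := p.2 J - L p.1.
have cF : continuous F.
  move=> p; apply: cvgB.
    by apply: (@continuous_comp _ _ _ snd (fun f => f J : R[i]^o));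
       [exact: cvg_snd|exact: ell2_eval_continuous].
  by apply: (@continuous_comp _ _ _ fst L); [exact: cvg_fst|exact: cL].
have clF : closed [set p | F p = 0].
  apply: (@preimage_closed _ _ F [set 0]); first by [].
  exact/accessible_closed_set1/hausdorff_accessible/norm_hausdorff.
move: Huv; rewrite /H_Z closureE => /(_ [set p | F p = 0]) Huv.
apply/eqP; rewrite -subr_eq0; apply/eqP; apply: Huv; split=> // -[f1 g1] /HL.
by rewrite /F /= => ->; rewrite subrr.
Qed.

End xxz_theory.

(* Main.v *)
(* On configurations, H acts by
     (H u)(J) = sum over the domain walls x of J of u(J) / 2 - u(flip_x J) / (2 Delta),
   and the number W(J) of domain walls is even. Pairing J with flip_x J gives
     (1 - 1/Delta) W / 2 <= H <= (1 + 1/Delta) W / 2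
   as forms. If l lies in a gap between these bounds, let s = 1 where W is large
   and s = -1 where W is small; in <s u, (H - l) u> the off-diagonal terms between
   the two regions cancel, so the form is at least c |u|^2, whence
   |(H - l) u| >= c |u|. The range of H - l is dense by an explicit iteration on
   the sectors with boundedly many particles, where H is bounded. Conversely, the
   vacuum is an eigenvector for 0, and truncated plane waves in the one-particle
   sector are Weyl sequences for the points of [1 - 1/Delta, 1 + 1/Delta]. *)

Require Import Defs.
From HB Require Import structures.
From mathcomp Require Import all_boot all_order all_algebra finmap.
From mathcomp Require Import complex.
From mathcomp Require Import all_classical all_reals all_analysis.
From mathcomp Require Import ring lra zify.

Import Order.TTheory GRing.Theory Num.Theory.
Import numFieldNormedType.Exports.

Local Open Scope classical_set_scope.
Local Open Scope complex_scope.
Local Open Scope ring_scope.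

Set Implicit Arguments.
Unset Strict Implicit.
Unset Printing Implicit Defensive.

Definition flip (x : int) (J : configuration) : configuration :=
  [fset tau x y | y in J]%fset.

Definition shift (J : configuration) : configuration :=
  [fset (y - 1)%R | y in J]%fset.

Definition walls (J : configuration) : configuration :=
  ((J `\` shift J) `|` (shift J `\` J))%fset.

Lemma tau_left x : tau x x = x + 1.
Proof. by rewrite /tau /= eqxx. Qed.

Lemma tau_right x : tau x (x + 1) = x.
Proof. by rewrite -[in LHS]tau_left tauK. Qed.

Lemma tau_other x y : y != x -> y != x + 1 -> tau x y = y.
Proof. by rewrite /tau /= => /negbTE -> /negbTE ->. Qed.

Lemma in_flip x J y : (y \in flip x J) = (tau x y \in J).
Proof. by rewrite -{1}[y](tauK x) mem_imfset//; exact: inv_inj (tauK x). Qed.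

Lemma flipK x : involutive (flip x).
Proof. exact: tau_imfsetK. Qed.

Lemma card_flip x J : #|` flip x J| = #|` J|.
Proof. by apply: card_imfset; exact: inv_inj (tauK x). Qed.

Lemma in_shift J y : (y \in shift J) = (y + 1 \in J).
Proof.
by rewrite -{1}[y](addrK 1) (@mem_imfset _ _ _ (fun y : int => y - 1))//; exact: addIr.
Qed.

Lemma card_shift J : #|` shift J| = #|` J|.
Proof. by apply: card_imfset; exact: addIr. Qed.

Lemma in_walls x J : (x \in walls J) = ((x \in J) != (x + 1 \in J)).
Proof. by rewrite !inE !in_shift; case: (x \in J); case: (x + 1 \in J). Qed.

Lemma walls_flip x J : (x \in walls (flip x J)) = (x \in walls J).
Proof. by rewrite !in_walls !in_flip tau_left tau_right eq_sym. Qed.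

Lemma card_walls J : #|` walls J| = (2 * (#|` J| - #|` (J `&` shift J)%fset|))%N.
Proof.
rewrite /walls cardfsU (_ : (_ `&` _)%fset = fset0); last first.
  by apply/fsetP => y; rewrite !inE; case: (y \in J); case: (_ \in shift J).
by rewrite cardfs0 subn0 !cardfsD card_shift [(shift J `&` J)%fset]fsetIC mul2n addnn.
Qed.

Lemma flip_notin_walls x J : x \notin walls J -> flip x J = J.
Proof.
rewrite in_walls negbK => /eqP xJ; apply/fsetP => y; rewrite in_flip.
have [->|yx] := eqVneq y x; first by rewrite tau_left.
have [->|yx1] := eqVneq y (x + 1); first by rewrite tau_right.
by rewrite tau_other.
Qed.

(* E is the powerset of a finite set of sites, large enough to be closed under
   all the flips that contribute to the sums. *)
Lemma wall_sumC (V : nmodType) (S : {fset configuration}) :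
  exists E : {fset configuration}, [/\ {subset S <= E},
    forall J x, x \in walls J -> flip x J \in S -> J \in E &
    forall F : configuration -> configuration -> V,
      (forall J K, J \notin S -> K \notin S -> F J K = 0) ->
      \sum_(J <- E) \sum_(x <- walls J) F J (flip x J) =
      \sum_(J <- E) \sum_(x <- walls J) F (flip x J) J].
Proof.
pose I0 : {fset int} := (\bigcup_(J <- S) J)%fset.
pose X : {fset int} := (I0 `|` shift I0)%fset.
pose I : {fset int} := (X `|` [fset (y + 1)%R | y in X])%fset.
pose E := fpowerset I.
have SI J x : J \in S -> x \in J -> x \in I0.
  by move=> JS xJ; apply/bigfcupP; exists J; rewrite ?JS.
have SX J x : J \in S -> x \in walls J -> x \in X.
  move=> JS; rewrite in_walls inE in_shift.
  have [xJ _|xJ /=] := boolP (x \in J); first by rewrite (SI J).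
  by rewrite eq_sym eqbF_neg negbK => /(SI _ _ JS) ->; rewrite orbT.
have EX x J : x \in X -> J \in E -> flip x J \in E.
  move=> xX; rewrite !fpowersetE => /fsubsetP JI; apply/fsubsetP => y.
  rewrite in_flip => yJ.
  have [->|yx] := eqVneq y x; first by rewrite inE xX.
  have [->|yx1] := eqVneq y (x + 1).
    by rewrite inE (in_imfset _ (fun y : int => y + 1)) ?orbT.
  by apply: JI; rewrite -(tau_other yx yx1).
have SE J : J \in S -> J \in E.
  by move=> JS; rewrite fpowersetE; apply/fsubsetP => x /(SI _ _ JS) xI; rewrite !inE xI.
exists E; split=> //.
  move=> J x xJ KS; rewrite -(flipK x J); apply: EX (SE _ KS).
  by apply: SX KS _; rewrite walls_flip.
have key (F : configuration -> configuration -> V) :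
    (forall J K, J \notin S -> K \notin S -> F J K = 0) ->
    \sum_(J <- E) \sum_(x <- walls J) F J (flip x J) =
    \sum_(x <- X) \sum_(J <- E) (if x \in walls J then F J (flip x J) else 0).
  move=> F0; rewrite exchange_big; apply: eq_bigr => J _ /=.
  pose b x := if x \in walls J then F J (flip x J) else 0.
  rewrite (@eq_big_seq _ _ _ _ _ _ b) => [|x xJ]; last by rewrite /b xJ.
  rewrite (@big_fset_incl _ _ _ _ (walls J) (walls J `|` X)%fset b); first last.
  - by move=> x _; rewrite /b => /negbTE ->.
  - exact: fsubsetUl.
  rewrite -(@big_fset_incl _ _ _ _ X (walls J `|` X)%fset b) ?fsubsetUr// => x.
  rewrite inE /b => xJX xX; case: ifP => // xJ; apply: F0.
    by apply: contra xX => JS; exact: SX xJ.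
  by apply: contra xX => JS; apply: (SX _ x JS); rewrite walls_flip.
move=> F F0; rewrite key// (key (fun J K => F K J)); last by move=> J K ? ?; exact: F0.
apply: eq_big_seq => x xX.
have pE : perm_eq (enum_fset E) [seq flip x J | J <- enum_fset E].
  apply: uniq_perm; rewrite ?map_inj_uniq ?fset_uniq//; first exact: inv_inj (flipK x).
  move=> J; apply/idP/mapP => [JE|[K KE ->]]; last exact: EX.
  by exists (flip x J); rewrite ?flipK//; exact: EX.
by rewrite (perm_big _ pE) big_map; apply: eq_bigr => J _; rewrite walls_flip flipK.
Qed.

Lemma sum_const_fset (R : pzSemiRingType) (T : choiceType) (A : {fset T}) (c : R) :
  \sum_(x <- A) c = #|` A|%:R * c.
Proof. by rewrite big_const_seq count_predT iter_addr_0 mulr_natl. Qed.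

Section finitely_supported.
Context (V : nmodType).
Implicit Types (S : {fset configuration}) (u : configuration -> V).

Definition supported S u := forall J, J \notin S -> u J = 0.

Definition finitely_supported u := exists S, supported S u.

Lemma supportedS S S' u : {subset S <= S'} -> supported S u -> supported S' u.
Proof. by move=> SS' uS J JS; apply: uS; apply: contra JS => /SS'. Qed.

End finitely_supported.

Section real_operator.
Context (R : realType).
Implicit Types (D l c t : R) (S : {fset configuration}).
Implicit Types (u v w : configuration -> R) (J K : configuration).

Definition dot u v : R := \sum_(J \in [set: configuration]) u J * v J.

Lemma dotE S u v : supported S u -> dot u v = \sum_(J <- S) u J * v J.
Proof. by move=> uS; apply: fsbigTE => J /uS ->; rewrite mul0r. Qed.

Lemma dotC u v : dot u v = dot v u.
Proof. by apply: eq_fsbigr => J _; rewrite mulrC. Qed.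

Lemma dot_ge0 u : finitely_supported u -> 0 <= dot u u.
Proof. by move=> [S uS]; rewrite (dotE _ uS) sumr_ge0// => J _; rewrite -expr2 sqr_ge0. Qed.

Lemma dot_subZ t u v : finitely_supported u -> finitely_supported v ->
  dot (fun J => u J - t * v J) (fun J => u J - t * v J) =
  dot u u - 2 * t * dot u v + t ^+ 2 * dot v v.
Proof.
move=> [S uS] [S' vS]; pose E := (S `|` S')%fset.
have {}uS : supported E u by apply: supportedS uS => J JS; rewrite inE JS.
have {}vS : supported E v by apply: supportedS vS => J JS; rewrite inE JS orbT.
rewrite !(@dotE E)//; last by move=> J JE; rewrite uS// vS// mulr0 subr0.
rewrite !mulr_sumr -sumrB -big_split/=; apply: eq_bigr => J _; ring.
Qed.

(* The operator H_Z0 on real functions; see H_Z0E. *)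
Definition hop D u J : R :=
  \sum_(x <- walls J) (u J / 2 - u (flip x J) / (2 * D)).

Definition shifted_hop D l u J : R := hop D u J - l * u J.

Lemma supported_hop D S E u : supported S u -> {subset S <= E} ->
    (forall J x, x \in walls J -> flip x J \in S -> J \in E) ->
  supported E (hop D u).
Proof.
move=> uS SE wE J JE; rewrite /hop big_seq big1// => x xJ.
rewrite !uS ?mul0r ?subr0//; first by apply: contra JE => /(wE _ _ xJ).
by apply: contra JE => /SE.
Qed.

Lemma finitely_supported_shifted_hop D l u :
  finitely_supported u -> finitely_supported (shifted_hop D l u).
Proof.
move=> [S uS]; have [E [SE wE _]] := wall_sumC R S.
exists E => J JE; rewrite /shifted_hop (supported_hop D uS SE wE)//.
by rewrite (supportedS SE uS)// mulr0 subr0.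
Qed.

(* Testing (H - l) u against s u: when s changes sign between J and flip x J,
   the off-diagonal terms of the pair cancel. *)
Lemma shifted_hop_lower_bound D l c (s : configuration -> R) u :
    0 < D -> 0 < c -> (forall J, s J = 1 \/ s J = -1) ->
    (forall J, c <= #|` walls J|%:R / 2 * (s J - D^-1) - s J * l) ->
    finitely_supported u ->
  c ^+ 2 * dot u u <= dot (shifted_hop D l u) (shifted_hop D l u).
Proof.
move=> D0 c0 s1 sc [S uS]; have [E [SE wE wC]] := wall_sumC R S.
have uE := supportedS SE uS.
have AE : supported E (shifted_hop D l u).
  move=> J JE; rewrite /shifted_hop (supported_hop D uS SE wE)//.
  by rewrite uE// mulr0 subr0.
have Di : 0 < D^-1 by rewrite invr_gt0.
rewrite (dotE _ uE) (dotE _ AE).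
have form : c * \sum_(J <- E) u J * u J <=
    \sum_(J <- E) s J * u J * shifted_hop D l u J.
  pose F J K := s J * u J * (u J / 2 - u K / (2 * D)).
  pose G J K := (s J - D^-1) / 2 * u J ^+ 2 + 0 * u K.
  have F0 J K : J \notin S -> K \notin S -> F J K = 0.
    by move=> /uS uJ /uS uK; rewrite /F uJ mulr0 mul0r.
  have G0 J K : J \notin S -> K \notin S -> G J K = 0.
    by move=> /uS uJ /uS uK; rewrite /G uJ uK !mulr0 expr0n mulr0 addr0.
  have FG : \sum_(J <- E) \sum_(x <- walls J) G J (flip x J) <=
            \sum_(J <- E) \sum_(x <- walls J) F J (flip x J).
    have half (a b : R) : a + a <= b + b -> a <= b by lra.
    apply: half.
    rewrite {2}(wC F F0) {2}(wC G G0) -!big_split/=; apply: ler_sum => J _.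
    rewrite -!big_split/=; apply: ler_sum => x _.
    set K := flip x J; rewrite /F /G invfM.
    have := sqr_ge0 (u J - u K); have := sqr_ge0 (u J + u K).
    by case: (s1 J) => ->; case: (s1 K) => ->; nra.
  have -> : \sum_(J <- E) s J * u J * shifted_hop D l u J =
      \sum_(J <- E) \sum_(x <- walls J) F J (flip x J) -
      \sum_(J <- E) s J * l * u J ^+ 2.
    rewrite -sumrB; apply: eq_bigr => J _.
    by rewrite /shifted_hop mulrBr {1}/hop mulr_sumr; congr (_ - _); ring.
  apply: le_trans (lerB FG (lexx _)); rewrite -sumrB mulr_sumr.
  apply: ler_sum => J _; rewrite /G.
  rewrite (@eq_bigr _ _ _ _ _ _ _ (fun=> (s J - D^-1) / 2 * u J ^+ 2)).
    rewrite sum_const_fset; have := sc J; have := sqr_ge0 (u J).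
    set X := u J ^+ 2 => X0 scJ; rewrite -expr2 -/X.
    have := ler_wpM2r X0 scJ; lra.
  by move=> x _; rewrite mul0r addr0.
have : 2 * c * (c * \sum_(J <- E) u J * u J) <=
    c ^+ 2 * (\sum_(J <- E) u J * u J) +
    \sum_(J <- E) shifted_hop D l u J * shifted_hop D l u J.
  apply: (le_trans (ler_wpM2l _ form)); first by rewrite mulr_ge0// ltW.
  rewrite !mulr_sumr -big_split/=; apply: ler_sum => J _.
  set A := shifted_hop _ _ _ _.
  by have := sqr_ge0 (c * u J - A); have := sqr_ge0 (c * u J + A); case: (s1 J) => ->; nra.
lra.
Qed.

Lemma hop_sym D u v : finitely_supported u -> finitely_supported v ->
  dot u (hop D v) = dot (hop D u) v.
Proof.
move=> [S1 u1] [S2 v2]; pose S := (S1 `|` S2)%fset.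
have uS : supported S u by apply: supportedS u1 => J JS; rewrite inE JS.
have vS : supported S v by apply: supportedS v2 => J JS; rewrite inE JS orbT.
have [E [SE wE wC]] := wall_sumC R S.
rewrite [RHS]dotC (dotE _ (supportedS SE uS)) (dotE _ (supportedS SE vS)).
pose F J K := u J * v K / (2 * D).
have F0 J K : J \notin S -> K \notin S -> F J K = 0.
  by move=> /uS uJ _; rewrite /F uJ !mul0r.
have E1 : \sum_(J <- E) u J * hop D v J =
    \sum_(J <- E) \sum_(x <- walls J) u J * v J / 2 -
    \sum_(J <- E) \sum_(x <- walls J) F J (flip x J).
  rewrite -sumrB; apply: eq_bigr => J _; rewrite -sumrB mulr_sumr.
  by apply: eq_bigr => x _; rewrite /F; ring.
rewrite E1 wC// -sumrB; apply: eq_bigr => J _; rewrite -sumrB mulr_sumr.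
by apply: eq_bigr => x _; rewrite /F; ring.
Qed.

Lemma dotBr u v w t : finitely_supported u ->
  dot u (fun J => v J - t * w J) = dot u v - t * dot u w.
Proof.
move=> [S uS]; rewrite !(dotE _ uS) mulr_sumr -sumrB.
by apply: eq_bigr => J _; ring.
Qed.

Lemma shifted_hop_sym D l u v : finitely_supported u -> finitely_supported v ->
  dot u (shifted_hop D l v) = dot (shifted_hop D l u) v.
Proof.
move=> fu fv; rewrite [RHS]dotC !dotBr// hop_sym//.
by rewrite (dotC v u) (dotC v (hop D u)).
Qed.

Lemma card_walls_le J : (#|` walls J| <= 2 * #|` J|)%N.
Proof. by rewrite card_walls leq_mul2l leq_subr orbT. Qed.

Lemma hop_upper_bound D n S u : 1 < D -> supported S u ->
    (forall J, u J != 0 -> (#|` J| <= n)%N) ->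
  dot (hop D u) (hop D u) <= (2 * n).+1%:R ^+ 2 * dot u u.
Proof.
move=> D1 uS un; have [E [SE wE wC]] := wall_sumC R S.
have vE := supported_hop D uS SE wE.
have uE := supportedS SE uS.
rewrite (dotE _ vE) (dotE _ uE).
have walls_le J : u J != 0 -> #|` walls J|%:R <= (2 * n).+1%:R :> R.
  by move=> /un Jn; rewrite ler_nat (leq_trans (card_walls_le J))// ltnW// ltnS leq_mul.
have hop_walls_le J : hop D u J != 0 -> #|` walls J|%:R <= (2 * n).+1%:R :> R.
  move=> uJ; have [Jn|nJ] := leqP #|` J| n.
    by rewrite ler_nat (leq_trans (card_walls_le J))// ltnW// ltnS leq_mul.
  case/eqP: uJ; rewrite /hop big1// => x _.
  have u0 K : (n < #|` K|)%N -> u K = 0.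
    by move=> nK; apply/eqP; apply: contraTT nK => /un; rewrite -leqNgt.
  by rewrite !u0 ?card_flip// !mul0r subr0.
set B : R := (2 * n).+1%:R.
have B0 : 0 < B by rewrite ltr0n.
pose F J K := u J / 2 - u K / (2 * D).
pose G J K := u J ^+ 2 + 0 * u K.
have G0 J K : J \notin S -> K \notin S -> G J K = 0.
  by move=> /uS uJ /uS uK; rewrite /G uJ uK expr0n mulr0 addr0.
have Gle : \sum_(J <- E) \sum_(x <- walls J) G J (flip x J) <=
    B * \sum_(J <- E) u J * u J.
  rewrite mulr_sumr; apply: ler_sum => J _.
  rewrite (@eq_bigr _ _ _ _ _ _ _ (fun=> u J ^+ 2)); last first.
    by move=> x _; rewrite /G mul0r addr0.
  rewrite sum_const_fset -expr2.
  have [->|uJ] := eqVneq (u J) 0; first by rewrite expr0n !mulr0.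
  by rewrite ler_wpM2r ?sqr_ge0// walls_le.
have FG : \sum_(J <- E) \sum_(x <- walls J) F J (flip x J) ^+ 2 <=
    \sum_(J <- E) \sum_(x <- walls J) G J (flip x J).
  have half (a b : R) : a + a <= b + b -> a <= b by lra.
  apply: half; rewrite {2}(wC _ G0) -!big_split/=; apply: ler_sum => J _.
  rewrite -!big_split/=; apply: ler_sum => x _; rewrite /F /G invfM.
  have Di0 : 0 <= D^-1 by rewrite invr_ge0; lra.
  have Di1 : D^-1 <= 1 by rewrite invf_le1; lra.
  set a := u J; set b := u (flip x J); set d := D^-1 in Di0 Di1 *.
  have : (b * d) ^+ 2 <= b ^+ 2.
    by rewrite exprMn ler_piMr ?sqr_ge0// expr_le1.
  have := sqr_ge0 (a + b * d); have -> : b * (2^-1 * d) = (b * d) / 2 by ring.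
  set e := b * d; nra.
have vv : B * (\sum_(J <- E) hop D u J * hop D u J) <=
    B * (B * \sum_(J <- E) \sum_(x <- walls J) F J (flip x J) ^+ 2).
  rewrite !mulr_sumr; apply: ler_sum => J _; set h := hop D u J.
  have : B * (h * h) + B * (h * h) <= #|`walls J|%:R * (h * h) +
      B * (B * \sum_(x <- walls J) F J (flip x J) ^+ 2).
    have -> : B * (h * h) + B * (h * h) =
        \sum_(x <- walls J) 2 * B * h * F J (flip x J).
      by rewrite -mulr_sumr -[\sum_(x <- _) _]/h; ring.
    rewrite 2!mulr_sumr -sum_const_fset -big_split/=; apply: ler_sum => x _.
    set f := F _ _; have := sqr_ge0 (h - B * f); nra.
  have [->|h0] := eqVneq h 0; first by rewrite !mulr0; lra.
  have : #|`walls J|%:R * (h * h) <= B * (h * h).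
    by rewrite ler_wpM2r -?expr2 ?sqr_ge0// hop_walls_le.
  lra.
rewrite ler_pM2l// in vv; rewrite expr2 -mulrA.
by apply: (le_trans vv); rewrite ler_pM2l//; apply: le_trans Gle.
Qed.

End real_operator.

Section dense_range.
Context (R : realType) (D l : R).
Implicit Types (u v w g : configuration -> R) (J K : configuration).
Local Notation A := (shifted_hop D l).

Lemma finitely_supported_subZ t u v : finitely_supported u -> finitely_supported v ->
  finitely_supported (fun J => u J - t * v J).
Proof.
move=> [S uS] [S' vS]; exists (S `|` S')%fset => J.
by rewrite inE negb_or => /andP[/uS -> /vS ->]; rewrite mulr0 subr0.
Qed.

Lemma hop_subZ t u v J :
  hop D (fun K => u K - t * v K) J = hop D u J - t * hop D v J.
Proof. by rewrite /hop mulr_sumr -sumrB; apply: eq_bigr => x _; ring. Qed.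

Lemma shifted_hop_subZ t u v J :
  A (fun K => u K - t * v K) J = A u J - t * A v J.
Proof. by rewrite /shifted_hop hop_subZ; ring. Qed.

Lemma shifted_hop_card n u : (forall J, u J != 0 -> (#|` J| <= n)%N) ->
  forall J, A u J != 0 -> (#|` J| <= n)%N.
Proof.
move=> un J; apply: contraNT; rewrite -ltnNge => nJ.
have u0 K : (n < #|` K|)%N -> u K = 0.
  by move=> nK; apply/eqP; apply: contraTT nK => /un; rewrite -leqNgt.
rewrite /shifted_hop /hop big1 => [|x _]; first by rewrite u0// mulr0 subr0.
by rewrite !u0 ?card_flip// !mul0r subr0.
Qed.

Lemma shifted_hop_upper_bound n : 1 < D -> exists2 k, 0 < k &
  forall u, finitely_supported u -> (forall J, u J != 0 -> (#|` J| <= n)%N) ->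
    dot (A u) (A u) <= k * dot u u.
Proof.
move=> D1; exists (2 * ((2 * n).+1%:R ^+ 2 + l ^+ 2)).
  by rewrite mulr_gt0// ltr_pwDl ?sqr_ge0// exprn_gt0.
move=> u fu un; have [S uS] := fu.
have fh : finitely_supported (hop D u).
  by have := finitely_supported_shifted_hop D 0 fu; congr finitely_supported;
    apply/funext => J; rewrite /shifted_hop mul0r subr0.
have Dn := hop_upper_bound D1 uS un.
have := dot_ge0 (finitely_supported_subZ (- l) fh fu).
by rewrite !dot_subZ//; lra.
Qed.

(* The range is dense because the iteration g_{m+1} = g_m - t A^2 g_m contracts
   residuals: on configurations with at most n elements A is bounded by
   sqrt k, and for t = 1/k the square of the norm drops by the factor
   1 - c^2/k. *)
Lemma shifted_hop_dense_range c g e : 1 < D -> 0 < c ->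
    (forall u, finitely_supported u -> c ^+ 2 * dot u u <= dot (A u) (A u)) ->
    finitely_supported g -> 0 < e ->
  exists2 u, finitely_supported u &
    dot (fun J => g J - A u J) (fun J => g J - A u J) < e.
Proof.
move=> D1 c0 low fg e0; have [S gS] := fg.
pose n := (\max_(J <- S) #|` J|)%N.
have gn J : g J != 0 -> (#|` J| <= n)%N.
  move=> gJ; have JS : J \in S by apply: contraNT gJ => /gS ->.
  by rewrite /n (big_rem J)//= leq_maxl.
have [k0 k00 up] := shifted_hop_upper_bound n D1.
pose k := k0 + c ^+ 2.
have k_gt0 : 0 < k by rewrite addr_gt0// exprn_gt0.
pose t := k^-1; have t0 : 0 < t by rewrite invr_gt0.
pose q := 1 - t * c ^+ 2.
have tc : t * c ^+ 2 < 1 by rewrite mulrC ltr_pdivrMr// /k mul1r; lra.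
have q0 : 0 <= q by rewrite /q; lra.
have q1 : q < 1 by rewrite /q; have := mulr_gt0 t0 (exprn_gt0 2 c0); lra.
pose res u J := g J - A u J.
have step m : exists u, [/\ finitely_supported u,
    forall J, u J != 0 -> (#|` J| <= n)%N & dot (res u) (res u) <= q ^+ m * dot g g].
  elim: m => [|m [u [fu un ur]]].
    exists (fun=> 0); split; first by exists fset0.
      by move=> J; rewrite eqxx.
    rewrite expr0 mul1r (_ : res _ = g)//; apply/funext => J.
    by rewrite /res /shifted_hop /hop big1 ?mulr0 ?subr0// => x _; rewrite !mul0r subrr.
  have resE v : res v = (fun J => g J - 1 * A v J) by apply/funext => J; rewrite mul1r.
  pose r := res u.
  have fr : finitely_supported r.
    rewrite /r resE; apply: finitely_supported_subZ => //.
    exact: finitely_supported_shifted_hop.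
  have rn J : r J != 0 -> (#|` J| <= n)%N.
    apply: contraNT => nJ; rewrite /r /res.
    have /eqP-> : g J == 0 by apply: contraNT nJ => /gn.
    have /eqP-> : A u J == 0 by apply: contraNT nJ => /(shifted_hop_card un).
    by rewrite subrr.
  have fA := finitely_supported_shifted_hop D l fr.
  have fAA := finitely_supported_shifted_hop D l fA.
  have An := shifted_hop_card rn.
  exists (fun J => u J - (- t) * A r J); split.
  - exact: finitely_supported_subZ.
  - move=> J; apply: contraNT => nJ.
    have /eqP-> : u J == 0 by apply: contraNT nJ => /un.
    have /eqP-> : A r J == 0 by apply: contraNT nJ => /An.
    by rewrite mulr0 subr0.
  rewrite (_ : res _ = fun J => r J - t * A (A r) J); last first.
    by apply/funext => J; rewrite /res shifted_hop_subZ /r /res; ring.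
  rewrite dot_subZ// shifted_hop_sym//.
  have h1 : dot (A (A r)) (A (A r)) <= k * dot (A r) (A r).
    apply: (le_trans (up _ fA An)); rewrite /k mulrDl lerDl.
    by rewrite mulr_ge0 ?sqr_ge0 ?dot_ge0.
  have h2 := low _ fr.
  have h3 : t ^+ 2 * dot (A (A r)) (A (A r)) <= t * dot (A r) (A r).
    rewrite expr2 -mulrA ler_pM2l// /t -ler_pdivlMl ?invr_gt0//.
    by rewrite invrK.
  have h4 : t * (c ^+ 2 * dot r r) <= t * dot (A r) (A r) by rewrite ler_pM2l.
  apply: (@le_trans _ _ (q * dot r r)); first by rewrite /q; lra.
  by rewrite exprS -mulrA ler_wpM2l.
have gg0 : 0 <= dot g g by exact: dot_ge0.
have [m qm] : exists m, q ^+ m * dot g g < e.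
  have q' : `|q| < 1 by rewrite ger0_norm.
  have cv : (fun m => q ^+ m * dot g g) @ \oo --> (0 : R).
    by rewrite -[0](mul0r (dot g g)); apply: cvgMr_tmp; exact: cvg_expr.
  have [m _ /(_ m (leqnn m))] := @cvgr_lt _ _ _ _ _ _ cv _ e0.
  by exists m.
have [u [fu _ ur]] := step m.
by exists u => //; exact: le_lt_trans qm.
Qed.

End dense_range.

Section ell2_theory.
Context (R : realType) (I : choiceType).
Local Notation N := (@ell2_norm R I).
Implicit Types (f g : ell2 R I) (A B : {fset I}) (u : I -> R[i]).

Definition weight (z : R[i]) : R := complex.Re z ^+ 2 + complex.Im z ^+ 2.

Lemma normc_sqr (z : R[i]) : Normc.normc z ^+ 2 = weight z.
Proof. by case: z => a b; rewrite sqr_sqrtr// addr_ge0 ?sqr_ge0. Qed.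

Lemma weight_ge0 (z : R[i]) : 0 <= weight z.
Proof. by rewrite addr_ge0 ?sqr_ge0. Qed.

Lemma sqnorm_le_fset u (b : R) :
  (forall A, \sum_(i <- A) weight (u i) <= b) -> (sqnorm u <= b%:E)%E.
Proof.
move=> ub; apply: ge_ereal_sup => _ [A [finA _] <-].
rewrite fsbig_finite//= sumEFin lee_fin.
by under eq_bigr do rewrite normc_sqr; exact: ub.
Qed.

Lemma fset_le_sqnorm u A : ((\sum_(i <- A) weight (u i))%:E <= sqnorm u)%E.
Proof.
apply: esum_ge; exists [set` A]; first by split=> //; exact: finite_fset.
rewrite fsbig_finite ?set_fsetK//=.
by rewrite sumEFin lee_fin; under [leRHS]eq_bigr do rewrite normc_sqr.
Qed.

Lemma le_sum_fset A B (F : I -> R) : (forall i, 0 <= F i) -> {subset A <= B} ->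
  \sum_(i <- A) F i <= \sum_(i <- B) F i.
Proof.
move=> F0 AB; rewrite (big_fsetID _ (mem A) B)/=.
rewrite (_ : [fset x in B | x \in A]%fset = A).
  by rewrite lerDl sumr_ge0.
by apply/fsetP => i; rewrite !inE/= andb_idl// => /AB.
Qed.

Lemma sqnorm_fset u A : (forall i, i \notin A -> u i = 0) ->
  sqnorm u = (\sum_(i <- A) weight (u i))%:E.
Proof.
move=> uA; apply/eqP; rewrite eq_le fset_le_sqnorm andbT.
apply: sqnorm_le_fset => B.
apply: (@le_trans _ _ (\sum_(i <- (A `|` B)%fset) weight (u i))).
  apply: le_sum_fset => i; first exact: weight_ge0.
  by rewrite inE => ->; rewrite orbT.
rewrite -(@big_fset_incl _ _ _ _ A)// ?fsubsetUl// => i _ /uA ->.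
by rewrite /weight expr0n addr0.
Qed.

Lemma ell2_normE_fset f A : (forall i, i \notin A -> f i = 0) ->
  N f ^+ 2 = \sum_(i <- A) weight (f i).
Proof. by move=> fA; apply: EFin_inj; rewrite ell2_norm_sqr (sqnorm_fset fA). Qed.

Lemma ell2_norm_ge0 f : 0 <= N f. Proof. exact: sqrtr_ge0. Qed.

Lemma ell2_norm_le_fset f (b : R) : 0 <= b ->
  (forall A, \sum_(i <- A) weight (f i) <= b ^+ 2) -> N f <= b.
Proof.
move=> b0 fb; rewrite -ler_sqr ?nnegrE ?ell2_norm_ge0//.
by rewrite -lee_fin ell2_norm_sqr; exact: sqnorm_le_fset.
Qed.

Lemma fset_le_ell2_norm f A : \sum_(i <- A) weight (f i) <= N f ^+ 2.
Proof. by rewrite -lee_fin ell2_norm_sqr; exact: fset_le_sqnorm. Qed.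

Lemma ell2_normN f : N (- f) = N f.
Proof. exact: (congr1 (@complex.Re R) (normrN f)). Qed.

Lemma ell2_norm0 : N 0 = 0.
Proof. by rewrite -[0 in LHS](scale0r 0) ell2_normZ Normc.normc0 mul0r. Qed.

Lemma ell2_distC f g : N (f - g) = N (g - f).
Proof. by rewrite -ell2_normN opprB. Qed.

Lemma ell2_dist_triangle f g h : N (f - h) <= N (f - g) + N (g - h).
Proof. by apply: le_trans (ell2_normD _ _); rewrite addrA subrK. Qed.

Lemma ell2_of_fset A u : exists2 f, ell2_0 f &
  forall i, f i = if i \in A then u i else 0.
Proof.
pose v i := if i \in A then u i else 0.
have vS : v \in @square_summable R I.
  rewrite inE (@sqnorm_fset v A) ?ltry// => i /negbTE iA.
  by rewrite /v iA.
exists (Ell2 vS) => //; apply: (@sub_finite_set _ _ [set` A]).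
  by move=> i /=; rewrite /v; case: ifP => //; rewrite eqxx.
exact: finite_fset.
Qed.

Lemma ell2_0_dense f (e : R) : 0 < e -> exists2 g, ell2_0 g & N (f - g) < e.
Proof.
move=> e0; have e20 : 0 < e / 2 by rewrite divr_gt0.
have [A fA] : exists A, N f ^+ 2 - (e / 2) ^+ 2 < \sum_(i <- A) weight (f i).
  apply/not_existsP => noA.
  have : (sqnorm f <= (N f ^+ 2 - (e / 2) ^+ 2)%:E)%E.
    by apply: sqnorm_le_fset => A; rewrite leNgt; apply/negP/noA.
  by rewrite -ell2_norm_sqr lee_fin; have := exprn_gt0 2 e20; lra.
have [g g0 gE] := ell2_of_fset A f; exists g => //.
apply: (@le_lt_trans _ _ (e / 2)); last by lra.
apply: ell2_norm_le_fset => [|B]; first exact: ltW.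
pose F i := if i \in A then 0 else weight (f i).
have -> : \sum_(i <- B) weight ((f - g) i) = \sum_(i <- B) F i.
  apply: eq_bigr => i _; rewrite -[(f - g) i]/(f i - g i) gE /F.
  by case: ifP; rewrite ?subrr ?subr0// /weight expr0n addr0.
apply: (@le_trans _ _ (\sum_(i <- (A `|` B)%fset) F i)).
  apply: le_sum_fset => i; last by rewrite inE => ->; rewrite orbT.
  by rewrite /F; case: ifP; rewrite ?weight_ge0.
have -> : \sum_(i <- (A `|` B)%fset) F i =
    \sum_(i <- (A `|` B)%fset) weight (f i) - \sum_(i <- A) weight (f i).
  apply/eqP; rewrite eq_sym subr_eq eq_sym; apply/eqP.
  have -> : \sum_(i <- A) weight (f i) =
      \sum_(i <- (A `|` B)%fset) if i \in A then weight (f i) else 0.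
    rewrite [LHS](@eq_big_seq _ _ _ _ _ _ (fun i => if i \in A then weight (f i) else 0)).
      by apply: big_fset_incl; rewrite ?fsubsetUl// => i _ /negbTE ->.
    by move=> i ->.
  rewrite -big_split/=; apply: eq_bigr => i _; rewrite /F.
  by case: ifP; rewrite ?add0r ?addr0.
by have := fset_le_ell2_norm f (A `|` B)%fset; lra.
Qed.

Lemma cauchy_limit (u : nat -> R) :
    (forall e : R, 0 < e -> exists n, forall m, (n <= m)%N -> `|u n - u m| < e) ->
  exists l : R, u @ \oo --> l.
Proof.
move=> cu; suff /cauchy_cvgP/cvg_ex[l ul] : cauchy (u @ \oo) by exists l.
apply: cauchy_exP => e e0; have [n un] := cu _ e0.
by exists (u n); exists n => // m /= nm; apply: un.
Qed.

Lemma ell2_complete (f : nat -> ell2 R I) :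
    (forall e : R, 0 < e -> exists n, forall m p, (n <= m)%N -> (n <= p)%N ->
      N (f m - f p) <= e) ->
  exists g, forall e : R, 0 < e -> exists n, forall m, (n <= m)%N ->
    N (f m - g) <= e.
Proof.
move=> cf.
have eval_lim (pr : R[i] -> R) : (forall x y, pr (x - y) = pr x - pr y) ->
    (forall x, `|pr x| <= Normc.normc x) ->
    forall i, exists l : R, (fun n => pr (f n i)) @ \oo --> l.
  move=> prB prn i; apply: cauchy_limit => e e0.
  have e20 : 0 < e / 2 by rewrite divr_gt0.
  have [n fn] := cf _ e20; exists n => m nm.
  apply: (@le_lt_trans _ _ (e / 2)); last by lra.
  rewrite -prB; apply: le_trans (prn _) _; apply: le_trans (fn n m _ nm) => //.
  by have := ell2_eval_le (f n - f m) i; rewrite -[_ <= _]/(_%:C <= _%:C) lecR.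
have Ren (x : R[i]) : `|complex.Re x| <= Normc.normc x.
  by have := normc_ge_Re x; rewrite -[_ <= _]/(_%:C <= _%:C) lecR.
have Imn (x : R[i]) : `|complex.Im x| <= Normc.normc x.
  rewrite -ler_sqr ?nnegrE ?normc_ge0// normc_sqr real_normK ?num_real// /weight lerDr.
  exact: sqr_ge0.
have /choice[a fa] := eval_lim (@complex.Re R) (fun '(_ +i* _) '(_ +i* _) => erefl) Ren.
have /choice[b fb] := eval_lim (@complex.Im R) (fun '(_ +i* _) '(_ +i* _) => erefl) Imn.
pose g0 i := a i +i* b i.
have lim_le (e : R) n : 0 <= e -> (forall m p, (n <= m)%N -> (n <= p)%N ->
      N (f m - f p) <= e) -> forall m, (n <= m)%N -> forall A,
    \sum_(i <- A) weight (f m i - g0 i) <= e ^+ 2.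
  move=> e0 fe m nm A.
  have cv : (fun p => \sum_(i <- A) weight (f m i - f p i)) @ \oo -->
      \sum_(i <- A) weight (f m i - g0 i).
    elim: (enum_fset A) => [|i s IH].
      rewrite big_nil (_ : (fun p => _) = cst 0); first exact: cvg_cst.
      by apply/funext => p; rewrite big_nil.
    rewrite big_cons (_ : (fun p => _) = (fun p => weight (f m i - f p i)) \+
       (fun p => \sum_(j <- s) weight (f m j - f p j))); last first.
      by apply/funext => p; rewrite big_cons.
    apply: cvgD => //.
    have wE (x y : R[i]) : weight (x - y) =
        (complex.Re x - complex.Re y) ^+ 2 + (complex.Im x - complex.Im y) ^+ 2.
      by case: x y => [? ?] [? ?].
    rewrite wE (_ : (fun p => _) = (fun p =>
      (complex.Re (f m i) - complex.Re (f p i)) *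
      (complex.Re (f m i) - complex.Re (f p i)) +
      (complex.Im (f m i) - complex.Im (f p i)) *
      (complex.Im (f m i) - complex.Im (f p i)))); last first.
      by apply/funext => p; rewrite wE !expr2.
    rewrite !expr2; apply: cvgD; apply: cvgM; apply: cvgB;
      (try exact: cvg_cst); (try exact: fa); exact: fb.
  apply: (cvgr_to_le cv); exists n => // p /= np.
  apply: le_trans (fset_le_ell2_norm (f m - f p) A) _.
  by rewrite ler_sqr ?nnegrE ?ell2_norm_ge0// fe.
have gS : g0 \in @square_summable R I.
  have [n fn] := cf _ ltr01.
  have dS : (fun i => f n i - g0 i) \in @square_summable R I.
    rewrite inE; apply: (@le_lt_trans _ _ 1%E); last exact: ltry.
    apply: sqnorm_le_fset => A; rewrite -[leRHS](expr1n _ 2).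
    exact: (lim_le _ _ ler01 fn).
  have -> : g0 = ell2_fun (f n - Ell2 dS).
    by apply/funext => i; rewrite -[RHS]/(f n i - (f n i - g0 i)) opprB addrC subrK.
  exact: ell2P.
exists (Ell2 gS) => e e0; have [n fn] := cf _ e0; exists n => m nm.
apply: ell2_norm_le_fset => [|A]; first exact: ltW.
exact: (lim_le _ _ (ltW e0) fn).
Qed.

Lemma graph_closureP (G : set (ell2 R I * ell2 R I)) f g :
  closure G (f, g) <-> forall e : R, 0 < e ->
    exists f' g', [/\ G (f', g'), N (f - f') < e & N (g - g') < e].
Proof.
have ballE (x y : ell2 R I) (e : R) : ball x e%:C y <-> N (x - y) < e.
  by rewrite -ball_normE; change ((N (x - y))%:C < e%:C <-> N (x - y) < e); rewrite ltcR.
split=> [cG e e0|H B].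
  have [[f' g'] [Gfg [/ballE ff /ballE gg]]] : G `&` ball (f, g) e%:C !=set0.
    by apply: cG; apply: nbhsx_ballx; rewrite ltcR.
  by exists f', g'.
move=> /nbhs_ballP[e /= e0 eB].
have e0' : 0 < complex.Re e by move: e0; rewrite ltcE => /andP[].
have eE : e = (complex.Re e)%:C by rewrite RRe_real// gtr0_real.
have [f' [g' [Gfg ff gg]]] := H _ e0'.
exists (f', g'); split => //; apply: eB; rewrite eE.
by split; apply/ballE.
Qed.

End ell2_theory.

Section closed_graph_resolvent.
Context (R : realType) (I : choiceType).
Local Notation V := (ell2 R I).
Local Notation N := (@ell2_norm R I).
Implicit Types (f g h : V) (G : set (V * V)) (z : R[i]).

Lemma ell2_addE f g i : (f + g) i = f i + g i. Proof. by []. Qed.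

Lemma ell2_oppE f i : (- f) i = - f i. Proof. by []. Qed.

Local Ltac ell2_ring :=
  apply: ell2_eqP => i; rewrite !(ell2_addE, ell2_oppE, ell2_scaleE); ring.

Definition linear_graph G := forall (a : R[i]) f h f' h',
  G (f, h) -> G (f', h') -> G (a *: f + f', a *: h + h').

Lemma ell2_norm_lin_dist (a : R[i]) f g f' g' :
  N (a *: f + f' - (a *: g + g')) <= Normc.normc a * N (f - g) + N (f' - g').
Proof.
rewrite (_ : _ - _ = a *: (f - g) + (f' - g')); last by ell2_ring.
by apply: le_trans (ell2_normD _ _) _; rewrite ell2_normZ.
Qed.

Lemma closure_linear_graph G : linear_graph G -> linear_graph (closure G).
Proof.
move=> linG a f h f' h' /graph_closureP fh /graph_closureP fh'.
apply/graph_closureP => e e0; pose k := Normc.normc a + 1.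
have a0 := normc_ge0 a.
have k0 : 0 < k by rewrite ltr_wpDl.
have ek0 : 0 < e / k by rewrite divr_gt0.
have kek : k * (e / k) = e by rewrite mulrCA divff ?mulr1// gt_eqF.
have [f1 [h1 [G1 ff1 hh1]]] := fh _ ek0.
have [f2 [h2 [G2 ff2 hh2]]] := fh' _ ek0.
have bound x y : x < e / k -> y < e / k -> Normc.normc a * x + y < e.
  move=> xe ye; rewrite -kek /k mulrDl mul1r; apply: ler_ltD => //.
  by rewrite ler_wpM2l// ltW.
exists (a *: f1 + f2), (a *: h1 + h2); split; first exact: linG.
- by apply: le_lt_trans (ell2_norm_lin_dist _ _ _ _ _) _; apply: bound.
- by apply: le_lt_trans (ell2_norm_lin_dist _ _ _ _ _) _; apply: bound.
Qed.

Lemma closure_lower_bound G z (c : R) : 0 < c ->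
    (forall f h, G (f, h) -> c * N f <= N (h - z *: f)) ->
  forall f h, closure G (f, h) -> c * N f <= N (h - z *: f).
Proof.
move=> c0 low f h /graph_closureP fh; apply/ler_addgt0Pr => e e0.
pose k := c + 1 + Normc.normc z.
have z0 := normc_ge0 z.
have k0 : 0 < k by rewrite /k; lra.
have ek0 : 0 < e / k by rewrite divr_gt0.
have kek : k * (e / k) = e by rewrite mulrCA divff ?mulr1// gt_eqF.
have [f1 [h1 [G1 ff1 hh1]]] := fh _ ek0.
have low1 := low _ _ G1.
have t1 : N f <= N f1 + N (f - f1).
  by apply: le_trans (ell2_normD _ _); rewrite addrC subrK.
have t2 : N (h1 - z *: f1) <= N (h - z *: f) + (Normc.normc z * N (f - f1) + N (h - h1)).
  rewrite -ell2_normZ (ell2_distC h h1).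
  apply: le_trans (lerD (lexx _) (ell2_normD _ _)).
  apply: le_trans (ell2_normD _ _); rewrite le_eqVlt; apply/orP; left.
  by apply/eqP; congr N; ell2_ring.
have t3 : c * N f <= c * (N f1 + N (f - f1)) by rewrite ler_wpM2l// ltW.
have t4 : c * N (f - f1) <= c * (e / k) by rewrite ler_wpM2l// ltW.
have t5 : Normc.normc z * N (f - f1) <= Normc.normc z * (e / k).
  by rewrite ler_wpM2l// ltW.
have : k * (e / k) = c * (e / k) + e / k + Normc.normc z * (e / k).
  by rewrite /k !mulrDl mul1r.
lra.
Qed.

Lemma dense_range_closure G z (c : R) : 0 < c -> linear_graph G ->
    (forall f h, G (f, h) -> c * N f <= N (h - z *: f)) ->
    (forall g (e : R), 0 < e -> exists f h, G (f, h) /\ N (g - (h - z *: f)) < e) ->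
  forall g, exists f, closure G (f, g + z *: f).
Proof.
move=> c0 linG low dense g.
have G_sub f h f' h' : G (f, h) -> G (f', h') -> G (f' - f, h' - h).
  by move=> Gf Gf'; have := linG (-1) _ _ _ _ Gf Gf'; rewrite !scaleN1r ![- _ + _]addrC.
have /choice[p Gp] : forall n, exists p : V * V,
    G p /\ N (g - (p.2 - z *: p.1)) < n.+1%:R^-1.
  move=> n; have n0 : (0 : R) < n.+1%:R^-1 by rewrite invr_gt0.
  by have [f [h [Gfh gn]]] := dense g _ n0; exists (f, h).
have small (e : R) : 0 < e -> exists n, forall m, (n <= m)%N -> m.+1%:R^-1 < e.
  move=> e0; have [n ne] := ltr_add_invr e0; exists n => m nm.
  by apply: le_lt_trans ne; rewrite add0r lef_pV2 ?posrE// ler_nat.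
have [f fn] : exists f, forall e : R, 0 < e -> exists n, forall m, (n <= m)%N ->
    N ((p m).1 - f) <= e.
  apply: ell2_complete => e e0; have ce0 : 0 < c * e / 2 by rewrite divr_gt0// mulr_gt0.
  have [n nce] := small _ ce0; exists n => m q nm nq.
  rewrite -(ler_pM2l c0).
  have [Gm pm] := Gp m; have [Gq pq] := Gp q.
  rewrite [p m]surjective_pairing in Gm; rewrite [p q]surjective_pairing in Gq.
  apply: le_trans (low _ _ (G_sub _ _ _ _ Gq Gm)) _.
  have -> : (p m).2 - (p q).2 - z *: ((p m).1 - (p q).1) =
      (g - ((p q).2 - z *: (p q).1)) - (g - ((p m).2 - z *: (p m).1)) by ell2_ring.
  apply: le_trans (ell2_normD _ _) _; rewrite ell2_normN.
  rewrite [c * e]splitr addrC; apply: lerD; apply: ltW.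
    by apply: lt_trans pm _; exact: nce.
  by apply: lt_trans pq _; exact: nce.
exists f; apply/graph_closureP => e e0.
pose k := 2 + Normc.normc z.
have z0 := normc_ge0 z.
have k0 : 0 < k by rewrite /k; lra.
have ek0 : 0 < e / k by rewrite divr_gt0.
have kek : k * (e / k) = e by rewrite mulrCA divff ?mulr1// gt_eqF.
have [n1 fn1] := fn _ ek0; have [n2 fn2] := small _ ek0.
pose n := maxn n1 n2.
have := fn1 n (leq_maxl _ _); have := fn2 n (leq_maxr _ _).
have [Gn pn] := Gp n; move: Gn pn; case: (p n) => f1 h1 /= Gn pn np ff.
have {np} pn := lt_trans pn np.
exists f1, h1; split => //.
  rewrite ell2_distC; apply: le_lt_trans ff _; rewrite -[ltRHS]kek.
  by rewrite /k mulrDl; have := mulr_ge0 z0 (ltW ek0); lra.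
have -> : g + z *: f - h1 = (g - (h1 - z *: f1)) + z *: (f - f1) by ell2_ring.
apply: le_lt_trans (ell2_normD _ _) _; rewrite ell2_normZ (ell2_distC f f1).
have := ler_wpM2l z0 ff; move: kek; rewrite /k mulrDl; lra.
Qed.

Lemma closure_resolvent G z (c : R) : 0 < c -> linear_graph G ->
    (forall f h, G (f, h) -> c * N f <= N (h - z *: f)) ->
    (forall g (e : R), 0 < e -> exists f h, G (f, h) /\ N (g - (h - z *: f)) < e) ->
  resolvent_set (closure G) z.
Proof.
move=> c0 linG low dense.
have linC := closure_linear_graph linG.
have lowC := closure_lower_bound c0 low.
have /choice[S GS] := dense_range_closure c0 linG low dense.
have uniq_S f g : closure G (f, g + z *: f) -> f = S g.
  move=> Gf; have := linC (-1) _ _ _ _ (GS g) Gf.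
  move=> /lowC; rewrite (_ : _ - _ = 0); last by ell2_ring.
  rewrite ell2_norm0 pmulr_rle0// => N0.
  have /ell2_norm0_eq0 : N (-1 *: S g + f) = 0.
    by apply/eqP; rewrite eq_le N0 ell2_norm_ge0.
  by rewrite scaleN1r addrC => /eqP; rewrite subr_eq0 => /eqP.
have linS : linear S.
  move=> a g g'; apply/esym/uniq_S.
  have := linC a _ _ _ _ (GS g) (GS g'); congr (closure G (_, _)); ell2_ring.
pose Sl : {linear V -> V} := HB.pack S (GRing.isLinear.Build _ _ _ _ S linS).
exists Sl; split; last first.
  by move=> f g; split=> [/uniq_S//|->]; exact: GS.
apply: bounded_linear_continuous; apply/bounded_funP => r.
exists ((c^-1)%:C * r) => g gr.
apply: (@le_trans _ _ ((c^-1)%:C * `|g|)); last first.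
  by rewrite ler_wpM2l// lecR invr_ge0 ltW.
rewrite -[(c^-1)%:C * `|g|]/((c^-1)%:C * (N g)%:C) -rmorphM/=.
change ((N (S g))%:C <= (c^-1 * N g)%:C); rewrite lecR ler_pdivlMl//.
by apply: le_trans (lowC _ _ (GS g)) _; rewrite addrK.
Qed.

Lemma resolvent_bounded G z (r : R) : resolvent_set (closure G) z ->
  exists M : R, forall f h, G (f, h) -> N (h - z *: f) <= r -> N f <= M.
Proof.
move=> [S [cS GS]].
have /bounded_funP/(_ r%:C)[M SM] := (linear_bounded_continuous S).2 cS.
exists (complex.Re M) => f h Gfh hr.
have {}Gfh : closure G (f, h - z *: f + z *: f).
  by rewrite subrK; exact: subset_closure.
have -> := (GS _ _).1 Gfh.
have : (N (S (h - z *: f)))%:C <= M.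
  by apply: SM; change ((N (h - z *: f))%:C <= r%:C); rewrite lecR.
by rewrite lecE => /andP[].
Qed.

End closed_graph_resolvent.

Section xxz_spectrum.
Context (R : realType) (D : R).
Local Notation N := (@ell2_norm R configuration).
Local Notation phi := (@ell2_basis R configuration).
Implicit Types (f g h : ell2 R configuration) (J K : configuration) (l c : R).

Definition re f J : R := complex.Re (f J).
Definition im f J : R := complex.Im (f J).

Lemma weightE (z : R[i]) :
  weight z = complex.Re z * complex.Re z + complex.Im z * complex.Im z.
Proof. by rewrite /weight !expr2. Qed.

Lemma ell2_0_re_im f :
  ell2_0 f <-> finitely_supported (re f) /\ finitely_supported (im f).
Proof.
split=> [/ell2_0_fset[S fS]|[[S fS] [S' fS']]].
  by split; exists S => J /fS; rewrite /re /im => ->.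
apply: (@sub_finite_set _ _ [set` (S `|` S')%fset]); last exact: finite_fset.
move=> J /=; apply: contra_neqT; rewrite inE negb_or => /andP[/fS + /fS'].
by rewrite /re /im; case: (f J) => a b /= -> ->.
Qed.

Lemma ell2_norm_dot f : finitely_supported (re f) -> finitely_supported (im f) ->
  N f ^+ 2 = dot (re f) (re f) + dot (im f) (im f).
Proof.
move=> [S fS] [S' fS']; pose E := (S `|` S')%fset.
have {}fS : supported E (re f) by apply: supportedS fS => J JS; rewrite inE JS.
have {}fS' : supported E (im f) by apply: supportedS fS' => J JS; rewrite inE JS orbT.
rewrite (dotE _ fS) (dotE _ fS') -big_split/= (@ell2_normE_fset _ _ _ E).
  by apply: eq_bigr => J _; rewrite weightE.
by move=> J JE; have := fS J JE; have := fS' J JE; rewrite /re /im; case: (f J) => a b /= -> ->.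
Qed.

Lemma card_edge x J :
  (#|` (J `&` [fset x; (x + 1)%R])%fset| == 1%N) = (x \in walls J).
Proof.
rewrite in_walls fsetIUr !fsetI1; have xx1 : x != x + 1.
  by rewrite eq_sym -subr_eq0 addrAC subrr.
case: ifP => _; case: ifP => _; rewrite ?fset0U ?fsetU0 ?cardfs1 ?cardfs0//.
by rewrite cardfs2 xx1.
Qed.

Lemma h_op_walls x f J : D != 0 -> ell2_0 f -> h_op D x f J =
  if x \in walls J then
    (1 / 2)%:C * f J - (1 / (2 * D))%:C * f (flip x J) else 0.
Proof.
move=> D0 f0; rewrite h_opE// card_edge -/(flip x J).
case: ifPn => [_|/flip_notin_walls ->]; last by rewrite !subrr !mulr0 subrr.
case: (f J) => a b; case: (f _) => a' b'; apply/eqP; rewrite eq_complex /=.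
by apply/andP; split; apply/eqP; field; rewrite D0.
Qed.

Lemma H_Z0E f h : D != 0 -> H_Z0 D (f, h) <-> ell2_0 f /\
  forall J, re h J = hop D (re f) J /\ im h J = hop D (im f) J.
Proof.
move=> D0; rewrite /H_Z0 /=.
have sumE J : ell2_0 f -> (\sum_(x \in [set: int]) h_op D x f) J =
    \sum_(x <- walls J) ((1 / 2)%:C * f J - (1 / (2 * D))%:C * f (flip x J)).
  move=> f0; have fin := h_op_finite D f0.
  pose Y := (walls J `|` fset_set [set x | h_op D x f != 0])%fset.
  rewrite (fsbigTE Y); last first.
    move=> x; rewrite inE negb_or => /andP[_]; rewrite in_fset_set// notin_setE/=.
    by move=> /negP; rewrite negbK => /eqP.
  rewrite ell2_sumE; under eq_bigr do rewrite h_op_walls//.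
  rewrite -(@big_fset_incl _ _ _ _ (walls J)) ?fsubsetUl//.
    by apply: eq_big_seq => x ->.
  by move=> x _ /negbTE ->.
have partE J : ell2_0 f ->
    re (\sum_(x \in [set: int]) h_op D x f) J = hop D (re f) J /\
    im (\sum_(x \in [set: int]) h_op D x f) J = hop D (im f) J.
  move=> f0; rewrite /re /im sumE//.
  have addE (x y : R[i]) : complex.Re (x + y) = complex.Re x + complex.Re y /\
      complex.Im (x + y) = complex.Im x + complex.Im y by case: x y => [? ?] [? ?].
  rewrite /hop; elim: (enum_fset (walls J)) => [|x s [IHr IHi]].
    by rewrite !big_nil.
  rewrite !big_cons !(addE _ _).1 !(addE _ _).2 IHr IHi.
  case: (f J) => a b; case: (f _) => a' b' /=.
  by split; congr (_ + _); field; rewrite D0.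
split=> [[f0 ->]|[f0 hE]]; split => //; first by move=> J; exact: partE.
apply: ell2_eqP => J; have [hr hi] := hE J; have [sr si] := partE J f0.
apply/eqP; rewrite eq_complex; apply/andP.
by split; apply/eqP; [rewrite [LHS]hr [RHS]sr|rewrite [LHS]hi [RHS]si].
Qed.

Lemma H_Z0_of_ell2_0 f : ell2_0 f -> exists h, H_Z0 D (f, h).
Proof. by move=> f0; exists (\sum_(x \in [set: int]) h_op D x f). Qed.

Lemma H_Z0_linear : D != 0 -> linear_graph (H_Z0 D).
Proof.
move=> D0 a f h f' h' /(H_Z0E _ _ D0)[/ell2_0_fset[S fS] hE].
move=> /(H_Z0E _ _ D0)[/ell2_0_fset[S' fS'] hE']; apply/H_Z0E => //; split.
  apply: (@sub_finite_set _ _ [set` (S `|` S')%fset]); last exact: finite_fset.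
  move=> J /=; apply: contra_neqT; rewrite inE negb_or => /andP[/fS fJ /fS' fJ'].
  by rewrite -[LHS]/(a * f J + f' J) fJ fJ' mulr0 addr0.
have ReE (x y z : R[i]) : complex.Re (x * y + z) =
    complex.Re x * complex.Re y - complex.Im x * complex.Im y + complex.Re z.
  by case: x y z => [? ?] [? ?] [? ?].
have ImE (x y z : R[i]) : complex.Im (x * y + z) =
    complex.Re x * complex.Im y + complex.Im x * complex.Re y + complex.Im z.
  by case: x y z => [? ?] [? ?] [? ?].
have reE u v J : re (a *: u + v) J =
    complex.Re a * re u J - complex.Im a * im u J + re v J.
  by rewrite /re ell2_addE ell2_scaleE ReE.
have imE u v J : im (a *: u + v) J =
    complex.Re a * im u J + complex.Im a * re u J + im v J.
  by rewrite /im ell2_addE ell2_scaleE ImE.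
move=> J; have [hr hi] := hE J; have [hr' hi'] := hE' J.
rewrite reE imE hr hi hr' hi' /hop !mulr_sumr -sumrB -!big_split.
by split; apply: eq_bigr => x _; rewrite ?reE ?imE /=; ring.
Qed.

Lemma re_sub f g J : re (f - g) J = re f J - re g J.
Proof. by rewrite /re ell2_addE ell2_oppE; case: (f J) (g J) => [? ?] [? ?]. Qed.

Lemma im_sub f g J : im (f - g) J = im f J - im g J.
Proof. by rewrite /im ell2_addE ell2_oppE; case: (f J) (g J) => [? ?] [? ?]. Qed.

Lemma re_shift f h l J : re (h - l%:C *: f) J = re h J - l * re f J.
Proof.
rewrite /re ell2_addE ell2_oppE ell2_scaleE.
by case: (h J) (f J) => [? ?] [? ?]; rewrite /=; ring.
Qed.

Lemma im_shift f h l J : im (h - l%:C *: f) J = im h J - l * im f J.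
Proof.
rewrite /im ell2_addE ell2_oppE ell2_scaleE.
by case: (h J) (f J) => [? ?] [? ?]; rewrite /=; ring.
Qed.

(* If the sign s of the test vector separates l from all the form bounds
   #walls / 2 * (1 -+ 1/D), then l is not in the spectrum. *)
Lemma H_Z_resolvent l c (s : configuration -> R) : 1 < D -> 0 < c ->
    (forall J, s J = 1 \/ s J = -1) ->
    (forall J, c <= #|` walls J|%:R / 2 * (s J - D^-1) - s J * l) ->
  resolvent_set (H_Z D) l%:C.
Proof.
move=> D1 c0 s1 sc; have D0 : D != 0 by rewrite gt_eqF//; lra.
have low u : finitely_supported u ->
    c ^+ 2 * dot u u <= dot (shifted_hop D l u) (shifted_hop D l u).
  by apply: (@shifted_hop_lower_bound _ _ _ _ s) => //; lra.
have fun_re f h : H_Z0 D (f, h) -> re (h - l%:C *: f) = shifted_hop D l (re f).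
  move=> /(H_Z0E _ _ D0)[_ hE]; apply/funext => J.
  by rewrite re_shift (hE J).1.
have fun_im f h : H_Z0 D (f, h) -> im (h - l%:C *: f) = shifted_hop D l (im f).
  move=> /(H_Z0E _ _ D0)[_ hE]; apply/funext => J.
  by rewrite im_shift (hE J).2.
apply: (closure_resolvent c0); first exact: H_Z0_linear.
- move=> f h fh; have /(H_Z0E _ _ D0)[/ell2_0_re_im[fr fi] _] := fh.
  rewrite -ler_sqr ?nnegrE ?mulr_ge0 ?ell2_norm_ge0 ?(ltW c0)//.
  have Ar := finitely_supported_shifted_hop D l fr.
  have Ai := finitely_supported_shifted_hop D l fi.
  rewrite exprMn !ell2_norm_dot ?fun_re ?fun_im// mulrDr.
  by apply: lerD; apply: low.
move=> g e e0; have e20 : 0 < e / 2 by rewrite divr_gt0.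
have [g0 /ell2_0_re_im[gr gi] gg0] := ell2_0_dense g e20.
have e30 : 0 < (e / 2) ^+ 2 / 2 by rewrite divr_gt0// exprn_gt0.
have [u fu ur] := shifted_hop_dense_range D1 c0 low gr e30.
have [v fv vi] := shifted_hop_dense_range D1 c0 low gi e30.
have [[S uS] [S' vS']] := (fu, fv).
have [f f0 fE] := ell2_of_fset (S `|` S')%fset (fun J => u J +i* v J).
have fr : re f = u.
  apply/funext => J; rewrite /re fE inE; case: ifPn => //.
  by rewrite negb_or => /andP[/uS ->].
have fi : im f = v.
  apply/funext => J; rewrite /im fE inE; case: ifPn => //.
  by rewrite negb_or => /andP[_ /vS' ->].
have [h fh] := H_Z0_of_ell2_0 f0; exists f, h; split => //.
set r := h - l%:C *: f.
apply: le_lt_trans (ell2_dist_triangle g g0 r) _; rewrite [ltRHS]splitr.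
apply: ltrD => //.
rewrite -ltr_sqr ?nnegrE ?ell2_norm_ge0 ?(ltW e20)//.
have rr : re (g0 - r) = fun J => re g0 J - shifted_hop D l u J.
  by apply/funext => J; rewrite -fr -(fun_re _ _ fh) re_sub.
have ii : im (g0 - r) = fun J => im g0 J - shifted_hop D l v J.
  by apply/funext => J; rewrite -fi -(fun_im _ _ fh) im_sub.
have fs1 (w w' : configuration -> R) : finitely_supported w -> finitely_supported w' ->
    finitely_supported (fun J => w J - shifted_hop D l w' J).
  move=> fw /(finitely_supported_shifted_hop D l)/(finitely_supported_subZ 1 fw).
  by congr finitely_supported; apply/funext => J; rewrite mul1r.
rewrite ell2_norm_dot ?rr ?ii; try exact: fs1.
lra.
Qed.

End xxz_spectrum.

Section xxz_bands.
Context (R : realType) (D : R).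
Local Notation N := (@ell2_norm R configuration).
Local Notation phi := (@ell2_basis R configuration).

Lemma H_Z_gap (k : nat) (l c : R) : 1 < D -> 0 < c ->
    (forall m, (m < k)%N -> m%:R * (1 + D^-1) + c <= l) ->
    (forall m, (k <= m)%N -> l + c <= m%:R * (1 - D^-1)) ->
  resolvent_set (H_Z D) l%:C.
Proof.
move=> D1 c0 lo hi.
pose m J := (#|` J| - #|` (J `&` shift J)%fset|)%N.
apply: (@H_Z_resolvent _ _ _ c (fun J => if (m J < k)%N then -1 else 1)) => // J.
  by case: ifP; auto.
rewrite card_walls -/(m J) natrM [2%:R * _]mulrC mulfK ?pnatr_eq0//.
by case: ltnP => [/lo|/hi]; lra.
Qed.

Lemma H_Z0_empty (a : R[i]) : H_Z0 D (a *: phi fset0, 0).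
Proof.
have phi0 J : (a *: phi fset0) J != 0 -> J = fset0.
  by rewrite ell2_scaleE ell2_basisE; case: (eqVneq J) => //= _; rewrite mulr0 eqxx.
have f0 : ell2_0 (a *: phi fset0).
  apply: (@sub_finite_set _ _ [set fset0]); last exact: finite_set1.
  by move=> J /phi0.
split => //=; rewrite fsbig1// => x _; apply: h_op_eq0 => // J /phi0 ->.
by rewrite !inE.
Qed.

Lemma normc_nat (n : nat) : Normc.normc (n%:R : R)%:C = n%:R.
Proof. by rewrite /= expr0n addr0 sqrtr_sqr ger0_norm. Qed.

Lemma ell2_norm_basis J : N (phi J) = 1.
Proof.
apply/eqP; rewrite -(@eqrXn2 _ 2) ?ell2_norm_ge0// expr1n.
rewrite (@ell2_normE_fset _ _ _ [fset J]%fset) => [|K].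
  by rewrite big_seq_fset1 ell2_basisE eqxx /weight /= expr1n expr0n addr0.
by rewrite inE ell2_basisE => /negbTE ->.
Qed.

Lemma spectrum_0 : spectrum (H_Z D) 0.
Proof.
move=> /(resolvent_bounded 0)[M NM].
pose n := Num.bound `|M|; pose a : R[i] := (n%:R)%:C.
have := NM _ _ (H_Z0_empty a); rewrite scale0r subr0 ell2_norm0 => /(_ (lexx _)).
rewrite ell2_normZ ell2_norm_basis mulr1 normc_nat leNgt => /negP; apply.
by apply: le_lt_trans (ler_norm M) _; exact: archi_boundP.
Qed.

Definition site (k : int) : configuration := [fset k]%fset.

Lemma H_Z0_site (k : int) : D != 0 ->
  H_Z0 D (phi (site k),
    phi (site k) - (1 / (2 * D))%:C *: (phi (site (k - 1)) + phi (site (k + 1)))).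
Proof.
move=> D0.
have phi0 J : phi (site k) J != 0 -> J = site k.
  by rewrite ell2_basisE; case: (eqVneq J) => //= _; rewrite eqxx.
have f0 : ell2_0 (phi (site k)).
  apply: (@sub_finite_set _ _ [set site k]); last exact: finite_set1.
  by move=> J /phi0.
split => //=.
have wall x : (x \in walls (site k)) = (x == k) || (x == k - 1).
  rewrite in_walls !inE -[x == k - 1](inj_eq (addIr 1)) subrK.
  have [->|_] := eqVneq x k; last by case: (x + 1 == k).
  have -> //= : (k + 1 == k) = false by apply/negbTE/eqP; lia.
set a := (1 / (2 * D))%:C; pose b : R[i] := (1 / 4 * (1 - 1 / D))%:C.
have ab : a + a + (b + b + (b + b)) = 1.
  rewrite /a /b -!(rmorphD (real_complex R)) -(rmorph1 (real_complex R)).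
  by congr (_%:C); field; rewrite D0.
have h_wall x K : x \in walls (site k) -> flip x (site k) = K ->
    h_op D x (phi (site k)) = - a *: (phi K - phi (site k)) -
      b *: (- phi (site k) - phi (site k)).
  by move=> xk <-; rewrite /h_op t_op_basis pi_op_basis card_edge xk.
have k1k : k - 1 + 1 = k by rewrite subrK.
rewrite (fsbigTE [fset k; (k - 1)%R]%fset); last first.
  move=> x; rewrite !inE negb_or => /andP[xk xk1]; apply: h_op_eq0 => // J /phi0 ->.
  by rewrite !inE xk; split=> //; apply/eqP; move/eqP: xk1; lia.
rewrite big_fsetU1 ?big_seq_fset1; last first.
  by rewrite inE; apply/eqP; lia.
rewrite (h_wall k (site (k + 1))) ?wall ?eqxx//; last first.
  by rewrite /flip imfset_fset1 tau_left.
rewrite (h_wall (k - 1) (site (k - 1))) ?wall ?eqxx ?orbT//; last first.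
  by rewrite /flip imfset_fset1 -{2}k1k tau_right.
apply: ell2_eqP => J; rewrite !(ell2_addE, ell2_oppE, ell2_scaleE).
by rewrite -[X in X - _]mul1r -ab; ring.
Qed.

Definition plane_wave (z : R[i]) n : ell2 R configuration :=
  \sum_(0 <= i < n) z ^+ i *: phi (site i).

Lemma H_Z0_plane_wave (z z' : R[i]) (l : R) n : D != 0 -> z * z' = 1 ->
    (1 - l)%:C = (1 / (2 * D))%:C * (z + z') ->
  H_Z0 D (plane_wave z n, l%:C *: plane_wave z n + (1 / (2 * D))%:C *:
    ((z ^+ n *: phi (site (n%:Z - 1)) - phi (site (- 1))) +
     z' *: (phi (site 0) - z ^+ n *: phi (site n)))).
Proof.
move=> D0 zz' lz; set a := (1 / (2 * D))%:C in lz *.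
have lE : l%:C = 1 - a * (z + z').
  by rewrite -lz rmorphB/= opprB addrC subrK.
elim: n => [|n IH].
  rewrite /plane_wave big_geq// sub0r.
  have := H_Z0_empty 0; rewrite scale0r; congr (H_Z0 D (_, _)).
  by apply: ell2_eqP => J; rewrite !(ell2_addE, ell2_oppE, ell2_scaleE); ring.
rewrite [plane_wave z n.+1](_ : _ = z ^+ n *: phi (site n) + plane_wave z n).
  have -> : n.+1%:Z - 1 = n by rewrite -addn1 PoszD addrK.
  have := H_Z0_linear D0 (z ^+ n) (H_Z0_site n D0) IH; rewrite -/a.
  have -> : (n%:Z + 1) = n.+1 by rewrite -addn1 PoszD.
  congr (H_Z0 D (_, _)).
  apply: ell2_eqP => J; rewrite !(ell2_addE, ell2_oppE, ell2_scaleE) lE exprS.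
  have : z ^+ n * z * z' = z ^+ n by rewrite -mulrA zz' mulr1.
  by set w := z ^+ n => wE; ring: wE.
by rewrite /plane_wave big_nat_recr//= addrC.
Qed.

End xxz_bands.

Section band.
Context (R : realType).
Local Notation N := (@ell2_norm R configuration).
Local Notation phi := (@ell2_basis R configuration).

Lemma normc_exp_unit (z : R[i]) n : Normc.normc z = 1 -> Normc.normc (z ^+ n) = 1.
Proof.
move=> z1; elim: n => [|n IH]; first by rewrite expr0 Normc.normc1.
by rewrite exprS Normc.normcM z1 IH mulr1.
Qed.

Lemma plane_wave_site (z : R[i]) n (j : nat) : (j < n)%N ->
  plane_wave z n (site j) = z ^+ j.
Proof.
move=> jn; rewrite /plane_wave ell2_sumE.
under eq_bigr do rewrite ell2_scaleE ell2_basisE.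
rewrite (bigD1_seq j) ?mem_index_iota ?iota_uniq//= big1 ?addr0.
  by rewrite eqxx mulr1.
move=> i ij; rewrite (_ : (_ == _) = false) ?mulr0//.
apply/negbTE/eqP => /fsetP/(_ j%:Z); rewrite !inE eqxx => /esym/eqP[] ji.
by rewrite ji eqxx in ij.
Qed.

Lemma plane_wave_norm (z : R[i]) n : Normc.normc z = 1 ->
  n%:R <= N (plane_wave z n) ^+ 2.
Proof.
move=> z1; pose s := [seq site i%:Z | i <- iota 0 n].
apply: le_trans (fset_le_ell2_norm _ (seq_fset tt s)).
have us : uniq s.
  rewrite map_inj_uniq ?iota_uniq// => i j /fsetP/(_ i%:Z).
  by rewrite !inE eqxx => /esym/eqP[].
have ps : perm_eq (enum_fset (seq_fset tt s)) s.
  by apply: uniq_perm => //; exact: seq_fsetE.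
rewrite (perm_big _ ps) big_map (@eq_big_seq _ _ _ _ _ _ (fun=> 1)).
  by rewrite big_const_seq count_predT size_iota iter_addr_0.
move=> i; rewrite mem_iota => /andP[_]; rewrite add0n => ni.
by rewrite plane_wave_site// -normc_sqr normc_exp_unit// expr1n.
Qed.

Lemma spectrum_band (D l : R) : 0 < D ->
  1 - 1 / D <= l <= 1 + 1 / D -> spectrum (H_Z D) l%:C.
Proof.
move=> D0 /andP[l1 l2]; have Dn0 : D != 0 by rewrite gt_eqF.
pose c := D * (1 - l); pose s := Num.sqrt (1 - c ^+ 2).
have c1 : c ^+ 2 <= 1.
  have DD : D * (1 / D) = 1 by rewrite mul1r divff.
  have lo : -1 <= c by have := ler_wpM2l (ltW D0) l2; rewrite /c; lra.
  have hi : c <= 1 by have := ler_wpM2l (ltW D0) l1; rewrite /c; lra.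
  by nra.
have cs : c ^+ 2 + s ^+ 2 = 1 by rewrite sqr_sqrtr ?subr_ge0// addrC subrK.
pose z := c +i* s; pose z' := c -i* s.
have zz' : z * z' = 1.
  by apply/eqP; rewrite eq_complex /=; apply/andP; split; apply/eqP; [rewrite -cs|]; ring.
have z1 : Normc.normc z = 1 by rewrite /= cs sqrtr1.
have z'1 : Normc.normc z' = 1 by rewrite /= sqrrN cs sqrtr1.
have lz : (1 - l)%:C = (1 / (2 * D))%:C * (z + z').
  by apply/eqP; rewrite eq_complex /= /c; apply/andP; split; apply/eqP; field.
pose a : R[i] := (1 / (2 * D))%:C.
move=> /(resolvent_bounded (Normc.normc a * 4))[M NM].
pose n := Num.bound (M ^+ 2).
have Nn : N (plane_wave z n) <= M.
  apply: (NM _ _ (H_Z0_plane_wave n Dn0 zz' lz)).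
  rewrite addrAC subrr add0r -/a ell2_normZ ler_wpM2l ?normc_ge0//.
  have pw1 J : N (z ^+ n *: phi J) = 1.
    by rewrite ell2_normZ ell2_norm_basis normc_exp_unit// mulr1.
  apply: le_trans (ell2_normD _ _) _; rewrite ell2_normZ z'1 mul1r.
  have -> : (4 : R) = (1 + 1) + (1 + 1) by ring.
  by apply: lerD; apply: le_trans (ell2_normD _ _) _;
    rewrite ell2_normN pw1 ell2_norm_basis.
have M0 : 0 <= M by apply: le_trans Nn; exact: ell2_norm_ge0.
have := plane_wave_norm n z1; rewrite leNgt => /negP; apply.
apply: le_lt_trans (archi_boundP (sqr_ge0 M)).
by rewrite ler_sqr ?nnegrE ?ell2_norm_ge0.
Qed.

End band.

Theorem proposition7p3 (R : realType) (Delta : R) (hDelta : 3 < Delta) :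
  spectrum (H_Z Delta) `&` [set x%:C | x in `]-oo, 2 - 2 / Delta[] =
  [set x%:C | x in [set 0] `|` `[1 - 1 / Delta, 1 + 1 / Delta]].
Proof.
have D0 : 0 < Delta by lra.
have D1 : 1 < Delta by lra.
have d0 : 0 < Delta^-1 by rewrite invr_gt0.
have d3 : 3 * Delta^-1 < 1 by rewrite ltr_pdivrMr// mul1r.
apply/seteqP; split=> [y [spec [l /= lD ly]]|_ [l /= lD <-]].
  rewrite -{y}ly in spec *; exists l => //=; apply: contrapT => /not_orP[/eqP l0].
  rewrite /= in_itv/= => /negP lband; apply: spec.
  move: lD; rewrite in_itv/= => l2.
  have step (k m : nat) (x : R) : (k <= m)%N -> 0 <= x -> k%:R * x <= m%:R * x.
    by move=> km x0; rewrite ler_wpM2r// ler_nat.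
  have d1 : 0 <= 1 - Delta^-1 by lra.
  have d1' : 0 <= 1 + Delta^-1 by lra.
  have [ln|lp] := ltP l 0.
    apply: (@H_Z_gap _ _ 0 _ (- l)) => // [|m m0]; first by lra.
    by have := step 0%N m _ m0 d1; lra.
  have lgt0 : 0 < l by rewrite lt_neqAle eq_sym l0.
  have [l1|l1] := ltP l (1 - Delta^-1).
    have cl : Num.min l (1 - Delta^-1 - l) <= l by rewrite ge_min lexx.
    have cr : Num.min l (1 - Delta^-1 - l) <= 1 - Delta^-1 - l by rewrite ge_min lexx orbT.
    apply: (@H_Z_gap _ _ 1 _ (Num.min l (1 - Delta^-1 - l))) => // [|m|m m1].
    - by rewrite lt_min lgt0 subr_gt0.
    - by rewrite ltnS leqn0 => /eqP ->; rewrite mul0r add0r.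
    - by have := step 1%N m _ m1 d1; lra.
  have [l3|l3] := leP l (1 + Delta^-1).
    by case/negP: lband; rewrite !div1r l1 l3.
  set c := Num.min (l - (1 + Delta^-1)) (2 - 2 / Delta - l).
  have cl : c <= l - (1 + Delta^-1) by rewrite ge_min lexx.
  have cr : c <= 2 - 2 / Delta - l by rewrite ge_min lexx orbT.
  apply: (@H_Z_gap _ _ 2 _ c) => // [|m|m m2].
  - by rewrite lt_min !subr_gt0 l3.
  - rewrite ltnS => m1; have := step m 1%N _ m1 d1'; lra.
  - by have := step 2%N m _ m2 d1; lra.
case: lD => [->|]; split.
- exact: spectrum_0.
- by exists 0 => //=; rewrite in_itv/=; lra.
- by apply: spectrum_band => //; move: b; rewrite in_itv.
- by exists l => //=; move: b; rewrite !in_itv/= => /andP[_]; lra.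
Qed.
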